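(* Let $K\subset\hat{\mathbb{C}}$ be an $E$-compactum. Then $K$ is a Peano compactum if and only if for every component $U$ of $\hat{\mathbb{C}}\setminus K$ the boundary $\partial U$ is a Peano compactum.
   Context: $\hat{\mathbb{C}}$ is the Riemann sphere with the spherical distance. A compactum is a compact metrizable space. A Peano compactum is a compactum all of whose components are locally connected and such that for every constant $C>0$ at most finitely many of its components have diameter greater than $C$. An $E$-compactum is a compactum $K\subset\hat{\mathbb{C}}$ such that for every $\varepsilon>0$ the complement $\hat{\mathbb{C}}\setminus K$ has at most finitely many components of diameter greater than $\varepsilon$. *)

(* Defs.v *)
From HB Require Import structures.
From mathcomp Require Import all_boot all_order all_algebra.
From mathcomp Require Import all_classical all_reals all_analysis.
From mathcomp Require Import complex.
From mathcomp Require Import ring lra.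

Set Implicit Arguments.
Unset Strict Implicit.
Unset Printing Implicit Defensive.

Import Order.TTheory GRing.Theory Num.Theory.

Local Open Scope classical_set_scope.
Local Open Scope ring_scope.

Definition riemann_sphere (R : realType) : Type := option R[i].

Section stereographic.
Context {R : realType}.
Implicit Types (z w : riemann_sphere R) (u v : R * R * R).

(* The inverse of the stereographic projection of the unit sphere of R^3 from
   its north pole (0, 0, 1), which is the image of the point None at infinity. *)
Definition stereo z : R * R * R :=
  if z is Some (a +i* b)%C then
    let n := a ^+ 2 + b ^+ 2 in
    (2 * a / (n + 1), 2 * b / (n + 1), (n - 1) / (n + 1))
  else (0, 0, 1).

Definition dot3 u v : R := u.1.1 * v.1.1 + u.1.2 * v.1.2 + u.2 * v.2.

(* Great-circle distance on the unit sphere. *)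
Definition spherical_dist z w : R := acos (dot3 (stereo z) (stereo w)).

Let dot3_stereo z : dot3 (stereo z) (stereo z) = 1.
Proof.
case: z => [[a b]|]; rewrite /dot3 /=; last by ring.
have n0 : a ^+ 2 + b ^+ 2 + 1 != 0.
  by rewrite gt_eqF// ltr_wpDl// addr_ge0// sqr_ge0.
by field.
Qed.

Let dot3_bound u v : dot3 u u = 1 -> dot3 v v = 1 -> -1 <= dot3 u v <= 1.
Proof.
case: u => [[a b] c]; case: v => [[d e] f]; rewrite /dot3 /= => hu hv.
have := sqr_ge0 (a - d); have := sqr_ge0 (b - e); have := sqr_ge0 (c - f).
have := sqr_ge0 (a + d); have := sqr_ge0 (b + e); have := sqr_ge0 (c + f).
by move=> *; apply/andP; split; lra.
Qed.

Let dot3_eq1 u v : dot3 u u = 1 -> dot3 v v = 1 -> dot3 u v = 1 -> u = v.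
Proof.
case: u => [[a b] c]; case: v => [[d e] f]; rewrite /dot3 /= => hu hv huv.
have s : (a - d) ^+ 2 + (b - e) ^+ 2 + (c - f) ^+ 2 = 0 by lra.
move/eqP: s; rewrite !paddr_eq0 ?addr_ge0 ?sqr_ge0// !sqrf_eq0 !subr_eq0.
by move=> /andP[/andP[/eqP-> /eqP->] /eqP->].
Qed.

Let stereo_inj : injective stereo.
Proof.
have n0 (a b : R) : a ^+ 2 + b ^+ 2 + 1 != 0.
  by rewrite gt_eqF// ltr_wpDl// addr_ge0// sqr_ge0.
have E (a b : R) : (a ^+ 2 + b ^+ 2 - 1) / (a ^+ 2 + b ^+ 2 + 1)
    = 1 - 2 / (a ^+ 2 + b ^+ 2 + 1) by have := n0 a b; move=> h; field.
have i0 (a b : R) : 2 / (a ^+ 2 + b ^+ 2 + 1) != 0.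
  by rewrite mulf_neq0// invr_eq0.
move=> [[a b]|] [[c d]|]//=; rewrite ?E => -[].
- rewrite -!(mulrAC _ _^-1) => h1 h2 /addrI/oppr_inj h.
  by move: h1 h2; rewrite h => /(mulfI (i0 _ _))-> /(mulfI (i0 _ _))->.
- by move=> _ _ /eqP; rewrite -subr_eq0 addrC addKr oppr_eq0 (negbTE (i0 _ _)).
- move=> _ _ /eqP.
  by rewrite eq_sym -subr_eq0 addrC addKr oppr_eq0 (negbTE (i0 _ _)).
Qed.

Let bnd z w : -1 <= dot3 (stereo z) (stereo w) <= 1.
Proof. exact: dot3_bound. Qed.

Lemma spherical_distxx z : spherical_dist z z = 0.
Proof. by rewrite /spherical_dist dot3_stereo acos1. Qed.

Lemma spherical_dist_positivity z w : spherical_dist z w = 0 -> z = w.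
Proof.
move=> h; apply: stereo_inj; apply: dot3_eq1 => //.
by rewrite -[LHS](@acosK R) ?in_itv/=// -/(spherical_dist z w) h cos0.
Qed.

Lemma spherical_dist_sym z w : spherical_dist z w = spherical_dist w z.
Proof.
rewrite /spherical_dist (_ : dot3 (stereo z) _ = dot3 (stereo w) (stereo z))//.
by rewrite /dot3; ring.
Qed.

Let gram u v (w : R * R * R) : dot3 u u = 1 -> dot3 v v = 1 -> dot3 w w = 1 ->
  (dot3 u w - dot3 u v * dot3 v w) ^+ 2 <=
  (1 - dot3 u v ^+ 2) * (1 - dot3 v w ^+ 2).
Proof.
move=> hu hv hw.
pose det := u.1.1 * (v.1.2 * w.2 - v.2 * w.1.2)
  - u.1.2 * (v.1.1 * w.2 - v.2 * w.1.1)
  + u.2 * (v.1.1 * w.1.2 - v.1.2 * w.1.1).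
have E : dot3 u u * dot3 v v * dot3 w w
    + 2 * dot3 u v * dot3 v w * dot3 u w - dot3 u u * dot3 v w ^+ 2
    - dot3 v v * dot3 u w ^+ 2 - dot3 w w * dot3 u v ^+ 2 = det ^+ 2.
  by rewrite /det /dot3; ring.
move: (sqr_ge0 det); rewrite -E hu hv hw => det0; rewrite -subr_ge0.
by apply: le_trans det0 _; rewrite le_eqVlt; apply/orP; left; apply/eqP; ring.
Qed.

Lemma spherical_dist_triangle w z t :
  spherical_dist z t <= spherical_dist z w + spherical_dist w t.
Proof.
rewrite /spherical_dist.
set x := dot3 (stereo z) (stereo w); set y := dot3 (stereo w) (stereo t).
set s := dot3 (stereo z) (stereo t).
have hx : -1 <= x <= 1 by exact: bnd.
have hy : -1 <= y <= 1 by exact: bnd.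
have hs : -1 <= s <= 1 by exact: bnd.
have [pile|ltpi] := leP pi (acos x + acos y).
  by rewrite (le_trans _ pile)// acos_lepi.
rewrite leNgt; apply/negP => lt.
have : cos (acos s) < cos (acos x + acos y).
  by rewrite ltr_cos// in_itv/= ?addr_ge0 ?acos_ge0 ?acos_lepi//= ltW.
rewrite cosD !acosK ?in_itv//= !sin_acos// -sqrtrM; last first.
  by case/andP: hx => *; nra.
apply/negP; rewrite -leNgt lerBlDr -lerBlDl.
rewrite (le_trans (ler_norm _))// -sqrtr_sqr ler_wsqrtr//.
by rewrite -sqrrN opprB gram.
Qed.

End stereographic.

HB.instance Definition _ (R : realType) := Choice.on (riemann_sphere R).
HB.instance Definition _ (R : realType) :=
  @isMetric.Build R (riemann_sphere R) spherical_dist spherical_distxx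
    spherical_dist_positivity spherical_dist_sym spherical_dist_triangle.

Definition components (T : topologicalType) (A : set T) : set (set T) :=
  [set connected_component A x | x in A].

Definition boundary (T : topologicalType) (A : set T) : set T :=
  closure A `\` interior A.

(* Local connectedness of A for its subspace topology. *)
Definition locally_connected (T : topologicalType) (A : set T) : Prop :=
  forall x, A x -> forall U, open U -> U x ->
  exists V, [/\ open V, V x, A `&` V `<=` U & connected (A `&` V)].

Section metric.
Context {R : realType} {T : metricType R}.
Implicit Types A K : set T.

Definition diam A : \bar R :=
  ereal_sup [set (mdist x y)%:E | x in A & y in A].

Definition peano_compactum K : Prop :=
  [/\ compact K,
      forall P, components K P -> locally_connected P &
      forall C : R, 0 < C ->
        finite_set [set P | components K P /\ (C%:E < diam P)%E]].

End metric.

Definition E_compactum (R : realType) (K : set (riemann_sphere R)) : Prop :=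
  compact K /\
  forall e : R, 0 < e ->
    finite_set [set U | components (~` K) U /\ (e%:E < diam U)%E].

(* Main.v *)
Require Import Defs.
From HB Require Import structures.
From mathcomp Require Import all_boot all_order all_algebra.
From mathcomp Require Import all_classical all_reals all_analysis.
From mathcomp Require Import complex.
From mathcomp Require Import ring lra.

Set Implicit Arguments.
Unset Strict Implicit.
Unset Printing Implicit Defensive.

Import Order.TTheory GRing.Theory Num.Theory.
Import numFieldNormedType.Exports.

Local Open Scope classical_set_scope.
Local Open Scope ring_scope.

(** The proof rests on two global facts about the sphere. It is unicoherent
([sphere_unicoherent]): two closed connected sets that cover it have a connected
intersection. And K_{3,3} does not embed in it, even when the edges are only
continua ([sphere_K33]). Both come from counting mod 2 along chains of small
steps. Unicoherence makes the boundary of every complementary domain of a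
continuum connected ([domain_boundary_connected]).

Let P be a nondegenerate component of K and W a component of the complement of
P. The link between P and the complement of K is [adjacent_component]: W
contains a component U of the complement of K whose boundary contains the
boundary of W, and the other components in W stay away from P. Indeed, P has
arbitrarily close neighbourhoods whose boundaries miss K; inside W these
boundaries contain connected pieces of diameter bounded below, which separate P
from a given point of W and lie in components of the complement of K. Only
finitely many of these components are large, so one U contains pieces
arbitrarily close to P.

If all boundaries of the components U are Peano compacta, then so is K. Two
close points of P are joined by a small continuum S of the sphere; each part of
S inside a component W of the complement of P is replaced by a small connected
subset of P, which is the boundary of W when W is small, and comes from the
local connectedness of the boundary of U for the finitely many large W
([joined_connected], [peano_components]). Large components of K produce large
components of boundaries of large U, so there are finitely many of them
([peano_nullity]).

Conversely let K be a Peano compactum. A nondegenerate component of the boundary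
of U is the boundary of W, where P is the component of K that contains it and W
the component of the complement of P that contains U ([boundary_component]).
This reduces the claim to the theorem of Torhorst ([torhorst]): the boundary of a
complementary domain W of a locally connected continuum P is locally connected.
Otherwise this boundary contains disjoint continua C_0, C_1, C_2 that all run
from near a point x to near a point t. Since P is locally connected at x and at
t, small continua J_0 and J_1 in P meet all three of them. Three disjoint
crossings C_j that each touch the disjoint connected sets J_0, J_1 and W form a
K_{3,3}, which is impossible ([no_three_crossings]). *)

(** * Connected sets, components and boundaries *)

Section connectedness.
Context {T : topologicalType}.
Implicit Types (A B C : set T) (x y z : T).

(** Connectedness as an induction principle: a property that is locally constant on
   a connected set and holds at one point holds everywhere. *)
Lemma connected_spread A (P : T -> Prop) x : connected A -> A x -> P x ->
  (forall z, A z -> exists2 N, nbhs z N & forall w, A w -> N w -> (P z <-> P w)) ->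
  forall y, A y -> P y.
Proof.
move=> cA Ax Px loc y Ay.
suff /seteqP[_ /(_ y Ay)[]] : A `&` P = A by [].
apply: cA; first by exists x.
- exists (interior [set w | A w -> P w]); first exact: open_interior.
  apply/seteqP; split=> z [Az].
    move=> Pz; split => //; have [N Nz NP] := loc z Az.
    by apply: filterS Nz => w Nw Aw /=; apply/(NP w).
  by move/nbhs_singleton => /(_ Az).
- exists (~` interior [set w | A w -> ~ P w]).
    exact/open_closedC/open_interior.
  apply/seteqP; split=> z [Az].
    by move=> Pz; split => // /nbhs_singleton /(_ Az).
  move=> nP; split => //; apply: contrapT => nPz; apply: nP.
  have [N Nz NP] := loc z Az.
  by apply: filterS Nz => w Nw Aw /= Pw; apply: nPz; apply/(NP w).
Qed.

Lemma connected_split A B C : connected A -> closed B -> closed C ->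
  A `<=` B `|` C -> A `&` B `&` C = set0 -> A `<=` B \/ A `<=` C.
Proof.
move=> cA clB clC ABC AB0; have [[x [Ax Bx]]|nB] := pselect (A `&` B !=set0).
  left; apply: (connected_spread cA Ax Bx) => z Az.
  have [Bz|Bz] := pselect (B z).
    exists (~` C); first last.
      by move=> w Aw Cw; split => // _; case: (ABC w Aw).
    apply: open_nbhs_nbhs; split; first exact: closed_openC.
    by move=> Cz; have : (A `&` B `&` C) z by []; rewrite AB0.
  exists (~` B) => //.
  by apply: open_nbhs_nbhs; split; first exact: closed_openC.
right=> x Ax; case: (ABC x Ax) => // Bx; exfalso; apply: nB; by exists x.
Qed.

Lemma connected_meets_boundary A B : connected A -> A `&` B !=set0 ->
  A `&` ~` B !=set0 -> A `&` boundary B !=set0.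
Proof.
move=> cA [x [Ax Bx]] [y [Ay nBy]]; apply: contrapT => nbd.
have AB z : A z -> closure B z -> interior B z.
  by move=> Az cBz; apply: contrapT => nB; apply: nbd; exists z.
have [|||||] := @connected_split A (closure B) (~` interior B) cA.
- exact: closed_closure.
- exact/open_closedC/open_interior.
- move=> z Az; have [|] := pselect (interior B z); last by right.
  by move=> /interior_subset Bz; left; exact: subset_closure.
- by rewrite -subset0 => z [[Az cz]] /(_ (AB _ Az cz)).
- by move=> /(_ y Ay) /(AB _ Ay) /interior_subset.
- by move=> /(_ x Ax); apply; apply: AB => //; exact: subset_closure.
Qed.

Lemma boundary_open A : open A -> boundary A = closure A `&` ~` A.
Proof. by move=> oA; rewrite /boundary (interior_id A).1. Qed.

Lemma boundary_closed A : closed (boundary A).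
Proof.
by apply: closedI; [exact: closed_closure|exact/open_closedC/open_interior].
Qed.

Lemma components_nonempty A P : components A P -> P !=set0.
Proof. by move=> [x Ax <-]; exists x; exact: connected_component_refl. Qed.

Lemma components_connected A P : components A P -> connected P.
Proof. by move=> [x Ax <-]; exact: component_connected. Qed.

Lemma components_sub A P : components A P -> P `<=` A.
Proof. by move=> [x Ax <-]; exact: connected_component_sub. Qed.

Lemma components_closed A P : closed A -> components A P -> closed P.
Proof. by move=> cA [x Ax <-]; exact: component_closed. Qed.

Lemma components_eq A P x : components A P -> P x ->
  P = connected_component A x.
Proof. by move=> [y Ay <-] Px; apply: same_connected_component. Qed.

Lemma components_max A P C : components A P -> connected C -> C `<=` A ->
  C `&` P !=set0 -> C `<=` P.
Proof.
move=> AP cC CA [x [Cx Px]]; rewrite (components_eq AP Px).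
exact: connected_component_max.
Qed.

Lemma components_inj A P Q : components A P -> components A Q ->
  P `&` Q !=set0 -> P = Q.
Proof. by move=> AP AQ [x [Px Qx]]; rewrite (components_eq AP Px) (components_eq AQ Qx). Qed.

Lemma components_component A x : A x -> components A (connected_component A x).
Proof. by exists x. Qed.

Lemma components_ex A C : connected C -> C !=set0 -> C `<=` A ->
  exists2 P, components A P & C `<=` P.
Proof.
move=> cC [x Cx] CA; exists (connected_component A x).
  exact/components_component/CA.
exact: connected_component_max.
Qed.

Lemma separated_subset A A' B B' : separated A' B' -> A `<=` A' -> B `<=` B' ->
  separated A B.
Proof.
move=> [h1 h2] AA BB; split; rewrite -subset0.
  by rewrite -h1; apply: setISS => //; exact: closureS.
by rewrite -h2; apply: setISS => //; exact: closureS.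
Qed.

(** If the complement of O split into a part containing A and another part E, then
   E, which can only be attached to O, would make the union of O and E a larger
   connected subset of the complement of A. *)
Lemma connected_compl_component A O : connected [set: T] -> connected A ->
  A !=set0 -> components (~` A) O -> connected (~` O).
Proof.
move=> cT cA [a Aa] OA; apply/connectedP => E [E0 EU sE].
have AO : A `<=` ~` O.
  by move=> x Ax Ox; apply: (components_sub OA Ox).
wlog AE : E E0 EU sE / A `<=` E false.
  move=> W; have [||h] := connected_subset sE _ cA; first by rewrite -EU.
    by move=> AE; exact: (W E).
  apply: (W (E \o negb)) => //=.
    by rewrite EU setUC.
  by rewrite separatedC.
have [h Eh] := E0 true.
have EO : E true `<=` ~` O by rewrite EU; right.
have cOH : connected (O `|` E true).
  apply/connectedP => M [M0 MU sM].
  have [c Oc] := components_nonempty OA.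
  wlog OM : M M0 MU sM / O `<=` M false.
    move=> W; have [||h'] := connected_subset sM _ (components_connected OA).
        by rewrite -MU; left.
      by move=> OM; exact: (W M).
    apply: (W (M \o negb)) => //=.
      by rewrite MU setUC.
    by rewrite separatedC.
  have MsubE : M true `<=` E true.
    move=> x Mx; have : (O `|` E true) x by rewrite MU; right.
    case=> // Ox; have : (M false `&` M true) x by split => //; exact: OM.
    by rewrite (separated_disjoint sM).
  have sepN : separated (M false `|` E false) (M true).
    have sepEM : separated (E false) (M true) by exact: separated_subset sE _ _.
    split; rewrite ?closureU ?setIUl.
      by rewrite sM.1 sepEM.1 setU0.
    by rewrite sM.2 sepEM.2 setU0.
  have dM z : M false z -> M true z -> False.
    by move=> Mf Mt; have : (M false `&` M true) z by []; rewrite (separated_disjoint sM).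
  have dE z : E false z -> E true z -> False.
    by move=> Mf Mt; have : (E false `&` E true) z by []; rewrite (separated_disjoint sE).
  have [|h'|/(_ c I)] := connected_subset sepN _ cT.
  - move=> x _; have [Ox|Ox] := pselect (O x); first by left; left; exact: OM.
    have : (~` O) x by []. rewrite EU => -[Ex|Ex]; first by left; right.
    have : (O `|` E true) x by right.
    by rewrite MU => -[|]; [left; left|right].
  - have [y My] := M0 true; have [Mf|Ef] := h' y I; first exact: (dM y).
    by apply: (dE y) => //; exact: MsubE.
  - by apply: dM; exact: OM.
have := components_max OA cOH.
have [c Oc] := components_nonempty OA.
move=> /(_ _ (ex_intro _ c (conj (or_introl Oc) Oc))).
move=> /(_ _ h (or_intror Eh)) => H; apply: (EO _ Eh); apply: H.
move=> x [|Ex]; first exact: components_sub.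
move=> Ax; have : (E false `&` E true) x by split => //; exact: AE.
by rewrite (separated_disjoint sE).
Qed.

End connectedness.

(** * Compactness and local connectedness in metric spaces *)

Section metric_space.
Context {R : realType} {T : metricType R}.
Implicit Types (A B C F : set T) (x y z : T) (d e : R).

Lemma ballP x e y : ball x e y <-> mdist x y < e.
Proof. by rewrite ballEmdist. Qed.

Lemma nbhs_mdist x (N : set T) :
  nbhs x N <-> exists2 d, 0 < d & forall y, mdist x y < d -> N y.
Proof.
split=> [/nbhs_ballP[d d0 dN]|[d d0 dN]].
  by exists d => // y /ballP; exact: dN.
by apply/nbhs_ballP; exists d => // y /ballP /dN.
Qed.

Lemma open_mdist (O : set T) x : open O -> O x ->
  exists2 d, 0 < d & forall y, mdist x y < d -> O y.
Proof. by move=> oO Ox; apply/nbhs_mdist/open_nbhs_nbhs. Qed.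

Lemma closure_mdist A x : closure A x <->
  forall d, 0 < d -> exists2 y, A y & mdist x y < d.
Proof.
split=> [cA d d0|h N /nbhs_mdist[d d0 dN]].
  have [|y [Ay dy]] := cA (ball x d); last by exists y => //; exact/ballP.
  by apply/nbhs_mdist; exists d => // y /ballP.
by have [y Ay xy] := h d d0; exists y; split => //; exact: dN.
Qed.

Lemma closed_mdist A x : closed A -> ~ A x ->
  exists2 d, 0 < d & forall y, A y -> d <= mdist x y.
Proof.
move=> cA nA; have [d d0 h] := open_mdist (closed_openC cA) nA.
by exists d => // y Ay; rewrite leNgt; apply/negP => /h.
Qed.

Lemma compact_closed_metric A : compact A -> closed A.
Proof. by apply: compact_closed; exact: metric_hausdorff. Qed.

(** The Lebesgue number argument: a bound that exists near every point of a compact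
   set, and that may be shrunk, can be chosen uniformly. *)
Lemma compact_uniform A (Q : T -> R -> Prop) : compact A ->
  (forall y e e', e' <= e -> Q y e -> Q y e') ->
  (forall x, A x -> exists2 d, 0 < d & forall y, A y -> mdist x y < d -> Q y d) ->
  exists2 d, 0 < d & forall y, A y -> Q y d.
Proof.
move=> /compact_near_coveringP/near_covering_withinP cA Qmono loc.
have H : \forall e \near 0^'+, A `<=` (fun y => Q y e).
  apply: cA => x Ax; have [d d0 dQ] := loc x Ax.
  exists (ball x d, [set e | e <= d]).
    split => /=; first by apply/nbhs_mdist; exists d => // y /ballP.
    exact: nbhs_right_le.
  move=> [y e] [/= /ballP xy ed] Ay; apply: (Qmono _ d) => //; exact: dQ.
near (0 : R)^'+ => e.
exists e => [|y Ay].
  by near: e; exact: nbhs_right_gt.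
have : A `<=` (fun y => Q y e) by near: e.
exact.
Unshelve. all: end_near. Qed.

Lemma disjoint_mdist A B : compact A -> closed B -> A `&` B = set0 ->
  exists2 d, 0 < d & forall a b, A a -> B b -> d <= mdist a b.
Proof.
move=> cA cB AB.
have [||d d0 h] := @compact_uniform A (fun y e => forall b, B b -> e <= mdist y b) cA.
- by move=> y e e' ee h b Bb; rewrite (le_trans ee)//; exact: h.
- move=> x Ax; have nB : ~ B x by move=> Bx; have : (A `&` B) x by []; rewrite AB.
  have [d d0 h] := closed_mdist cB nB.
  exists (d / 2) => [|y Ay xy b Bb]; first by rewrite divr_gt0.
  have := h b Bb; have := metric_triangle x y b; lra.
by exists d => // a b Aa Bb; exact: h.
Qed.

Lemma compact_directed F (D : set (set T)) (O : set T) : compact F -> D !=set0 ->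
  (forall A, D A -> closed A /\ A `<=` F) ->
  (forall A B, D A -> D B -> D (A `&` B)) -> open O ->
  (forall x, (forall A, D A -> A x) -> O x) -> exists2 A, D A & A `<=` O.
Proof.
move=> cF [A0 DA0] Dcl DI oO DO; apply: contrapT => nex.
pose G := filter_from D (fun A => A `\` O).
have PG : ProperFilter G.
  apply: filter_from_proper.
    apply: filter_from_filter; first by exists A0.
    move=> A B DA DB; exists (A `&` B); first exact: DI.
    by move=> x [[Ax Bx] nO]; split; split.
  move=> A DA; apply: contrapT => nA; apply: nex; exists A => // x Ax.
  by apply: contrapT => nO; apply: nA; exists x.
have GF : G F by exists A0 => // x []; move=> /(Dcl _ DA0).2.
have [p [Fp clp]] := cF G PG GF.
have cl A : D A -> (A `\` O) p.
  move=> DA; have cAO : closed (A `\` O).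
    by apply: closedI; [exact: (Dcl _ DA).1|exact: open_closedC].
  rewrite (closure_id (A `\` O)).1// => N Np; have [|x [h h']] := clp (A `\` O) N _ Np.
    by exists A.
  by exists x.
have [_] := cl _ DA0; apply; apply: DO => A DA; exact: (cl A DA).1.
Qed.

Lemma separated_closed A B C : closed C -> C = A `|` B -> separated A B -> closed A.
Proof.
move=> cC CE [s1 s2]; apply/closure_id/seteqP; split; first exact: subset_closure.
move=> x cx; have : C x.
  rewrite (closure_id C).1//; apply: closureS cx; rewrite CE; by left.
by rewrite CE => -[//|Bx]; have : (closure A `&` B) x by []; rewrite s1.
Qed.

(** In a compact set components coincide with quasicomponents, so a component has
   arbitrarily small relatively clopen neighbourhoods D. *)
Lemma compact_component_clopen F x (N : set T) : compact F -> F x -> open N ->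
  connected_component F x `<=` N ->
  exists D E, [/\ closed D, closed E, F = D `|` E, D `&` E = set0 &
    connected_component F x `<=` D /\ D `<=` N].
Proof.
move=> cF Fx oN sub; have clF := compact_closed_metric cF.
pose D := [set A | [/\ closed A, closed (F `\` A), A `<=` F & A x]].
have D0 : D !=set0 by exists F; split => //; rewrite setDv; exact: closed0.
have Dcl A : D A -> closed A /\ A `<=` F by case.
have DI A B : D A -> D B -> D (A `&` B).
  move=> [cA cA' AF Ax] [cB cB' BF Bx]; split => //; first exact: closedI.
    by rewrite setDIr; exact: closedU.
  by move=> z [/AF].
pose Q := [set z | forall A, D A -> A z].
have QF : Q `<=` F by move=> z; have [A DA] := D0 => /(_ A DA) /(Dcl _ DA).2.
have clQ : closed Q.
  rewrite (_ : Q = \bigcap_(A in D) A); last by apply/seteqP; split => z h A /h.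
  by apply: closed_bigI => A [].
have cQ : connected Q.
  apply/connectedP => E [E0 EU sE].
  have Qx : Q x by move=> A [].
  wlog Ex : E E0 EU sE / E false x.
    move=> W; have : Q x by []. rewrite EU => -[h|h]; first exact: (W E).
    apply: (W (E \o negb)) => //=; first by rewrite EU setUC.
    by rewrite separatedC.
  have c0 : closed (E false) by exact: separated_closed clQ EU sE.
  have c1 : closed (E true).
    by apply: separated_closed clQ _ _; last rewrite separatedC; rewrite ?EU 1?setUC.
  have k0 : compact (E false).
    by apply: subclosed_compact c0 cF _ => z Ez; apply: QF; rewrite EU; left.
  have [d d0 dE] := disjoint_mdist k0 c1 (separated_disjoint sE).
  pose U := \bigcup_(z in E false) (ball z (d / 2))°.
  pose V := \bigcup_(z in E true) (ball z (d / 2))°.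
  have oU : open U by apply: bigcup_open => z _; exact: open_interior.
  have oV : open V by apply: bigcup_open => z _; exact: open_interior.
  have inb z : interior (ball z (d / 2)) z.
    by apply/nbhs_mdist; exists (d / 2) => [|y /ballP//]; rewrite divr_gt0.
  have UV z : U z -> V z -> False.
    move=> [a Ea /interior_subset/ballP az] [b Eb /interior_subset/ballP bz].
    have := dE a b Ea Eb; have := metric_triangle a z b.
    rewrite (metric_sym z b); lra.
  have [||A DA AUV] := @compact_directed F D (U `|` V) cF D0 Dcl DI.
  - exact: openU.
  - move=> z /= Qz; have : Q z by []. rewrite EU => -[Ez|Ez]; [left|right]; by exists z.
  have DU : D (A `\` V).
    have [cA cA' AF Ax] := DA; split.
    - by apply: closedI => //; exact: open_closedC.
    - rewrite (_ : F `\` _ = (F `\` A) `|` (A `\` U)).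
        by apply: closedU => //; apply: closedI => //; exact: open_closedC.
      apply/seteqP; split => z.
        move=> [Fz nAV]; have [Az|Az] := pselect (A z); last by left.
        right; split => // Uz; apply: nAV; split => // Vz; exact: (UV z).
      move=> [[Fz nA]|[Az nU]]; first by split => // -[].
      split; first exact: AF. by move=> [_ nV]; case: (AUV z Az).
    - by move=> z [/AF].
    - split => // Vx; apply: (UV x) => //; by exists x.
  have [b Eb] := E0 true; have : Q b by rewrite EU; right.
  move=> /(_ _ DU)[_]; apply; by exists b.
have [A DA AN] : exists2 A, D A & A `<=` N.
  apply: (compact_directed cF) => // z Qz; apply: sub.
  by apply: (connected_component_max _ QF cQ) => // A [].
have [cA cA' AF Ax] := DA.
exists A, (F `\` A); split => //.
- by rewrite setDUK.
- by rewrite setDIK.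
split => // z Cz; have [||//|h] := connected_split (@component_connected _ F x) cA cA'.
- by move=> w /connected_component_sub Fw; have [|] := pselect (A w); [left|right].
- by rewrite -subset0 => w [[_ Aw] []].
- exact.
- by have [] := h x (connected_component_refl Fx).
Qed.

Lemma open_mdist_lt x e : open [set y | mdist x y < e].
Proof.
rewrite openE => y /= xy; apply/nbhs_mdist; exists (e - mdist x y) => [|z yz].
  by rewrite subr_gt0.
by rewrite /= (le_lt_trans (metric_triangle x y z))// -ltrBrDl.
Qed.

Lemma open_mdist_gt x e : open [set y | e < mdist x y].
Proof.
rewrite openE => y /= xy; apply/nbhs_mdist; exists (mdist x y - e) => [|z yz].
  by rewrite subr_gt0.
have := metric_triangle x z y; rewrite (metric_sym z y) /=; lra.
Qed.

Lemma closed_mdist_le x e : closed [set y | mdist x y <= e].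
Proof.
rewrite (_ : mkset _ = ~` [set y | e < mdist x y]).
  exact/open_closedC/open_mdist_gt.
by apply/seteqP; split => y /=; rewrite leNgt => /negP.
Qed.

Lemma closed_mdist_ge x e : closed [set y | e <= mdist x y].
Proof.
rewrite (_ : mkset _ = ~` [set y | mdist x y < e]).
  exact/open_closedC/open_mdist_lt.
by apply/seteqP; split => y /=; rewrite leNgt => /negP.
Qed.

(** Boundary bumping: otherwise the component would have a clopen neighbourhood in
   the closed ball that stays in the open ball, hence is clopen in B. *)
Lemma component_bump B x y e : compact B -> connected B -> B y -> mdist x y < e ->
  (exists2 z, B z & e <= mdist x z) ->
  exists2 t, connected_component (B `&` [set z | mdist x z <= e]) y t & e <= mdist x t.
Proof.
move=> kB cB By xy [z Bz xz]; set F := B `&` _; apply: contrapT => nex.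
have clB := compact_closed_metric kB.
have kF : compact F by apply: compact_closedI => //; exact: closed_mdist_le.
have Fy : F y by split => //; exact: ltW.
have [|D [E [cD cE FE DE0 [CD Dlt]]]] :=
    compact_component_clopen kF Fy (@open_mdist_lt x e).
  by move=> t Ct /=; rewrite ltNge; apply/negP => h; apply: nex; exists t.
have [|||h|h] := @connected_split _ B D (E `|` (B `&` [set z | e <= mdist x z])) cB cD.
- by apply: closedU => //; apply: closedI => //; exact: closed_mdist_ge.
- move=> w Bw; have [h|h] := leP e (mdist x w); first by right; right.
  have : F w by split => //; exact: ltW.
  by rewrite FE => -[]; [left|right; left].
- rewrite -subset0 => w [[Bw Dw] [Ew|[_ h]]].
    by have : (D `&` E) w by []; rewrite DE0.
  by have /= := Dlt w Dw; rewrite ltNge h.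
- by have /= := Dlt z (h z Bz); rewrite ltNge xz.
have Dy := CD y (connected_component_refl Fy).
have [Ey|[_ /=]] := h y By; first by have : (D `&` E) y by []; rewrite DE0.
by rewrite leNgt xy.
Qed.

(** For compact sets this is equivalent to local connectedness; the joining sets are
   closed, so that finite unions of them are continua. *)
Definition unif_loc_connected A := forall e, 0 < e -> exists2 d, 0 < d &
  forall x y, A x -> A y -> mdist x y < d ->
  exists S, [/\ connected S, closed S, S x /\ S y, S `<=` A &
    forall z, S z -> mdist x z < e].

Lemma locally_connected_unif A : compact A -> locally_connected A ->
  unif_loc_connected A.
Proof.
move=> kA lA e e0.
pose Q x d := forall y, A y -> mdist x y < d ->
  exists S, [/\ connected S, closed S, S x /\ S y, S `<=` A &
    forall z, S z -> mdist x z < e].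
have [||d d0 h] := @compact_uniform A Q kA.
- by move=> x d d' dd h y Ay xy; apply: h => //; exact: lt_le_trans dd.
- move=> x Ax.
  have [||V [oV Vx AV cV]] := lA x Ax [set y | mdist x y < e / 4].
  + exact: open_mdist_lt.
  + by rewrite /= mdistxx divr_gt0.
  have [d d0 dV] := open_mdist oV Vx.
  have m0 : 0 < Num.min (d / 2) (e / 4) by rewrite lt_min !divr_gt0.
  exists (Num.min (d / 2) (e / 4)) => // y Ay; rewrite lt_min => /andP[xy xye].
  move=> z Az; rewrite lt_min => /andP[yz yze].
  have Vy : V y by apply: dV; lra.
  have Vz : V z by apply: dV; have := metric_triangle x y z; lra.
  exists (closure (A `&` V)); split.
  + exact: connected_closure.
  + exact: closed_closure.
  + by split; apply: subset_closure.
  + move=> w cw; rewrite (closure_id A).1; last exact: compact_closed_metric.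
    by apply: closureS cw.
  + move=> w /closure_mdist /(_ (e / 4)); rewrite divr_gt0// => /(_ isT)[v /AV /= xv wv].
    have := metric_triangle y x w; have := metric_triangle x v w.
    rewrite (metric_sym v w) (metric_sym y x); lra.
by exists d => // x y Ax; exact: h.
Qed.

(** Connectedness im kleinen at every point suffices: the components of relatively
   open sets are then relatively open. *)
Lemma im_kleinen_locally_connected A :
  (forall x e, A x -> 0 < e -> exists2 d, 0 < d &
    forall y, A y -> mdist x y < d -> exists S, [/\ connected S, S x, S y, S `<=` A &
      forall z, S z -> mdist x z < e]) ->
  locally_connected A.
Proof.
move=> h x Ax U oU Ux.
pose Q := connected_component (A `&` U) x.
have QA : Q `<=` A `&` U by exact: connected_component_sub.
have Qx : Q x by exact: connected_component_refl.
have Qn z : Q z -> interior (~` A `|` Q) z.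
  move=> Qz; have [Az Uz] := QA z Qz.
  have [e e0 eU] := open_mdist oU Uz; have [d d0 dS] := h z e Az e0.
  apply/nbhs_mdist; exists d => // y zy.
  have [Ay|] := pselect (A y); [right|by left].
  have [S [cS Sz Sy SA Se]] := dS y Ay zy.
  apply: (connected_component_trans Qz); exists S => //; split => // w Sw.
  by split; [exact: SA|exact/eU/Se].
exists (interior (~` A `|` Q)).
have E : A `&` interior (~` A `|` Q) = Q.
  apply/seteqP; split => z; first by move=> [Az /interior_subset[]].
  by move=> Qz; split; [exact: (QA z Qz).1|exact: Qn].
split; [exact: open_interior|exact: Qn| |].
  by rewrite E => z /QA[].
by rewrite E; exact: component_connected.
Qed.

Lemma cvg_real_mdist (f : T -> R) x : (forall e, 0 < e -> exists2 d, 0 < d &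
    forall y, mdist x y < d -> `|f x - f y| < e) -> f @ x --> f x.
Proof.
move=> h; apply/cvgrPdist_lt => e /h[d d0 dP].
by apply/nbhs_mdist; exists d.
Qed.

Lemma connected_chain C e x y : connected C -> C x -> C y -> 0 < e ->
  exists n (f : nat -> T), [/\ f 0%N = x, f n = y, forall i, C (f i) &
    forall i, (i < n)%N -> mdist (f i) (f i.+1) < e].
Proof.
move=> cC Cx Cy e0.
apply: (@connected_spread _ C (fun y => exists n (f : nat -> T),
  [/\ f 0%N = x, f n = y, forall i, C (f i) &
    forall i, (i < n)%N -> mdist (f i) (f i.+1) < e]) x cC Cx _ _ y Cy).
  by exists 0%N, (fun=> x).
have step z w : C z -> C w -> mdist z w < e -> (exists n (f : nat -> T),
  [/\ f 0%N = x, f n = z, forall i, C (f i) &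
    forall i, (i < n)%N -> mdist (f i) (f i.+1) < e]) -> exists n (f : nat -> T),
  [/\ f 0%N = x, f n = w, forall i, C (f i) &
    forall i, (i < n)%N -> mdist (f i) (f i.+1) < e].
  move=> Cz Cw zw [n [f [f0 fn Cf fe]]].
  exists n.+1, (fun i => if (i <= n)%N then f i else w); split => //.
  - by rewrite ltnn.
  - by move=> i; case: ifP.
  - move=> i /=; rewrite ltnS => ilen; rewrite ilen.
    case: (ltnP i n) => h; first exact: fe.
    by have -> : i = n; [apply/eqP; rewrite eqn_leq ilen|rewrite fn].
move=> z Cz; exists [set w | mdist z w < e].
  by apply/nbhs_mdist; exists e.
move=> w Cw /= zw; split; apply: step => //.
by rewrite metric_sym.
Qed.

Lemma diam_gtP A (c : R) : (c%:E < diam A)%E <->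
  exists x y, [/\ A x, A y & c < mdist x y].
Proof.
split=> [/ereal_sup_gt[_ [x Ax [y Ay <-]]]|[x [y [Ax Ay xy]]]].
  by rewrite lte_fin => ?; exists x, y.
apply: (@lt_le_trans _ _ (mdist x y)%:E); first by rewrite lte_fin.
by apply: ereal_sup_ubound; exists x => //; exists y.
Qed.

Lemma diam_le_mdist A (c : R) x y : ~ (c%:E < diam A)%E -> A x -> A y ->
  mdist x y <= c.
Proof.
move=> nc Ax Ay; rewrite leNgt; apply/negP => h; apply: nc.
by apply/diam_gtP; exists x, y.
Qed.

Lemma diam_gt_subset A B (c : R) : A `<=` B -> (c%:E < diam A)%E ->
  (c%:E < diam B)%E.
Proof.
move=> AB /diam_gtP[x [y [Ax Ay h]]]; apply/diam_gtP; exists x, y.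
by split => //; exact: AB.
Qed.

Lemma diam_closure_gt A (c : R) : (c%:E < diam (closure A))%E -> (c%:E < diam A)%E.
Proof.
move=> /diam_gtP[x [y [/closure_mdist cx /closure_mdist cy xy]]]; apply/diam_gtP.
have e0 : 0 < (mdist x y - c) / 2 by rewrite divr_gt0// subr_gt0.
have [x' Ax' xx'] := cx _ e0; have [y' Ay' yy'] := cy _ e0.
exists x', y'; split => //.
have := metric_triangle x x' y; have := metric_triangle x' y' y.
rewrite (metric_sym y' y); lra.
Qed.
End metric_space.

(** * Parity of crossings in the plane *)

Section plane_metric.
Context {R : realType}.

Let maxdist (p q : R * R) := Num.max `|p.1 - q.1| `|p.2 - q.2|.

Let maxdist_ge0 p q : 0 <= maxdist p q.
Proof. by rewrite /maxdist le_max normr_ge0. Qed.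

Let maxdist_positivity p q : maxdist p q = 0 -> p = q.
Proof.
case: p q => [a b] [c d]; rewrite /maxdist /= => h.
have : `|a - c| <= 0 by rewrite -h le_max lexx.
have : `|b - d| <= 0 by rewrite -h le_max lexx orbT.
by rewrite !normr_le0 !subr_eq0 => /eqP-> /eqP->.
Qed.

Let ball_maxdist p e : ball p e = [set q | maxdist p q < e].
Proof.
apply/seteqP; split => q; rewrite /maxdist /= gt_max; last by move=> /andP[].
by move=> [/= h h']; apply/andP; split; [exact: h|exact: h'].
Qed.

HB.instance Definition _ := @PseudoMetric_isMetric.Build R (R * R)%type maxdist
  maxdist_ge0 maxdist_positivity ball_maxdist.

Lemma mdist_plane (p q : R * R) : mdist p q = Num.max `|p.1 - q.1| `|p.2 - q.2|.
Proof. by []. Qed.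

End plane_metric.

Section crossing_parity.
Context {R : realType}.
Implicit Types (p q u v w : R * R) (k : R).

(** The half-open half plane that contains exactly one of v and -v for every nonzero
   vector v. *)
Definition upper v := (0 < v.2) || ((v.2 == 0) && (0 < v.1)).

(** Whether a short step from u to v crosses the positive half-axis. Along a closed
   chain of short steps the number of crossings is the winding number mod 2. *)
Definition axis_cross u v := (0 < u.1) && (upper u (+) upper v).

Definition far_from0 k v := (k <= `|v.1|) || (k <= `|v.2|).

Lemma far_from0N k v : far_from0 k (- v) = far_from0 k v.
Proof. by rewrite /far_from0 /= !normrN. Qed.

Lemma upperN v : v != 0 -> upper (- v) = ~~ upper v.
Proof.
case: v => a b; rewrite -[0]/(0, 0) xpair_eqE /upper /= !oppr_gt0 oppr_eq0.
by case: (ltgtP b 0); case: (ltgtP a 0).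
Qed.

Lemma upper_neq k u v : 0 < k -> mdist u v < k -> far_from0 k u ->
  upper u != upper v -> k <= `|u.1|.
Proof.
rewrite mdist_plane gt_max /far_from0 /upper => k0 /andP[_ h2] /orP[//|h] up.
exfalso; move: h2 h up; case: u v => [a b] [c d] /=.
case: (ltgtP b 0) => hb; case: (ltgtP d 0) => hd //=.
- by rewrite (ltr0_norm hb) ltr_norml => /andP[]; lra.
- by rewrite (ltr0_norm hb) ltr_norml => /andP[]; lra.
- by rewrite (gtr0_norm hb) ltr_norml => /andP[]; lra.
- by rewrite (gtr0_norm hb) ltr_norml => /andP[]; lra.
- by rewrite hb normr0 => ?; rewrite leNgt k0.
- by rewrite hb normr0 => ?; rewrite leNgt k0.
- by rewrite hb normr0 => ?; rewrite leNgt k0.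
Qed.

Lemma sign_eq k (a b : R) : 0 < k -> `|a - b| < k -> k <= `|a| -> k <= `|b| ->
  (0 < a) = (0 < b).
Proof.
move=> k0; rewrite ltr_norml => /andP[h1 h2].
case: (ltgtP a 0) => ha; case: (ltgtP b 0) => hb //; rewrite ?ha ?hb ?normr0;
  try lra.
- rewrite (ltr0_norm ha) (gtr0_norm hb); lra.
- rewrite (gtr0_norm ha) (ltr0_norm hb); lra.
Qed.

Lemma mdist_sign k u v : 0 < k -> mdist u v < k -> k <= `|u.1| -> k <= `|v.1| ->
  (0 < u.1) = (0 < v.1).
Proof. by rewrite mdist_plane gt_max => k0 /andP[+ _]; exact: sign_eq. Qed.

(** Short steps far from the origin that leave the half plane do so on one side of
   the origin, so three nearby vectors all see the positive half-axis or all see the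
   negative one. *)
Lemma axis_cross_cocycle k u v w : 0 < k -> mdist u v < k -> mdist v w < k ->
  mdist u w < k -> far_from0 k u -> far_from0 k v -> far_from0 k w ->
  axis_cross u v (+) axis_cross v w = axis_cross u w.
Proof.
move=> k0 uv vw uw fu fv fw; rewrite /axis_cross.
have vu : mdist v u < k by rewrite metric_sym.
have sgn : upper v != upper w -> upper v != upper u \/ upper u != upper w ->
    (0 < u.1) = (0 < v.1).
  move=> h h'; apply: (mdist_sign k0 uv); last exact: (upper_neq k0 vw).
  case: h' => h'; last exact: (upper_neq k0 uw).
  by apply: (upper_neq k0 uv) => //; rewrite eq_sym.
move: sgn; case: (upper u); case: (upper v); case: (upper w) => //= sgn;
  rewrite ?andbF ?andbT ?addbF ?addFb //.
- by rewrite sgn//; right.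
- by rewrite sgn ?addbb//; left.
- by rewrite sgn ?addbb//; left.
- by rewrite sgn//; right.
Qed.

(** Crossing the negative half-axis is the same as changing half planes without
   crossing the positive one. *)
Lemma axis_crossN k u v : 0 < k -> mdist u v < k -> far_from0 k u -> far_from0 k v ->
  axis_cross (- u) (- v) = axis_cross u v (+) upper u (+) upper v.
Proof.
move=> k0 uv fu fv.
have nz w : far_from0 k w -> w != 0.
  by case: w => a b; apply: contraTneq => -[-> ->]; rewrite /far_from0/= normr0 orbb -ltNge.
rewrite /axis_cross !upperN ?nz// oppr_gt0.
have := upper_neq k0 uv fu; case: (upper u); case: (upper v) => //= h;
  rewrite ?andbF ?andbT//; move: (h isT) => {}h.
  by rewrite addbF addbT; case: (ltgtP u.1 0) h => // ->; rewrite normr0 leNgt k0.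
by rewrite addbF addbT; case: (ltgtP u.1 0) h => // ->; rewrite normr0 leNgt k0.
Qed.

End crossing_parity.

Section grid.

Let glue_right (h v v' h' S w S' : bool) : h (+) v' = v (+) h' ->
  S (+) v = w (+) S' -> (S (+) h) (+) v' = w (+) (S' (+) h').
Proof. by case: h v v' h' S w S' => [] [] [] [] [] [] []. Qed.

Let glue_top (h0 h1 h2 v0 w0 v1 w1 : bool) : h0 (+) v1 = v0 (+) h1 ->
  h1 (+) w1 = w0 (+) h2 -> h0 (+) (v1 (+) w1) = (v0 (+) w0) (+) h2.
Proof. by case: h0 h1 h2 v0 w0 v1 w1 => [] [] [] [] [] [] []. Qed.

(** A discrete Stokes formula: when every cell of a grid is balanced, so is the
   boundary of the grid. *)
Lemma grid_boundary (H V : nat -> nat -> bool) n m :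
  (forall s t, (s < n)%N -> (t < m)%N ->
    H s t (+) V s.+1 t = V s t (+) H s t.+1) ->
  (\big[addb/false]_(s < n) H s 0%N) (+) (\big[addb/false]_(t < m) V n t) =
  (\big[addb/false]_(t < m) V 0%N t) (+) (\big[addb/false]_(s < n) H s m).
Proof.
elim: m => [|m IH] hyp; first by rewrite !big_ord0 addbF.
have row n' : (n' <= n)%N -> \big[addb/false]_(s < n') H s m (+) V n' m =
    V 0%N m (+) \big[addb/false]_(s < n') H s m.+1.
  elim: n' => [|n' IH'] n'n; first by rewrite !big_ord0 addbF.
  rewrite !big_ord_recr /=.
  exact: glue_right (hyp n' m n'n (ltnSn m)) (IH' (ltnW n'n)).
rewrite !big_ord_recr /=; apply: glue_top (row n (leqnn n)).
exact: IH (fun s t hs ht => hyp s t hs (leqW ht)).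
Qed.
End grid.

Section linking.
Context {R : realType}.
Implicit Types (f g : nat -> R * R) (n m : nat) (p : R * R) (k : R).

Lemma mdist_subr p q r : mdist (p - r) (q - r) = mdist p q.
Proof. by rewrite !mdist_plane /= !opprB !addrA !subrK. Qed.

Lemma mdist_subl p q r : mdist (r - p) (r - q) = mdist p q.
Proof.
rewrite metric_sym !mdist_plane /= !opprB; congr Num.max; congr `|_|; ring.
Qed.

(** The winding number mod 2 of the chain f around p, when f is closed. *)
Definition cross_parity f n p : bool :=
  \big[addb/false]_(s < n) axis_cross (f s - p) (f s.+1 - p).

Lemma cross_parity_rev f n p k : 0 < k ->
  (forall s, (s <= n)%N -> far_from0 k (f s - p)) ->
  (forall s, (s < n)%N -> mdist (f s) (f s.+1) < k) ->
  \big[addb/false]_(s < n) axis_cross (p - f s) (p - f s.+1) =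
  cross_parity f n p (+) upper (f 0%N - p) (+) upper (f n - p).
Proof.
move=> k0 far step; rewrite /cross_parity.
elim: n far step => [|n IH] far step; first by rewrite !big_ord0 addFb addbb.
rewrite !big_ord_recr /= IH; last 2 first.
- by move=> s sn; apply: far; exact: leqW.
- by move=> s sn; apply: step; exact: leqW.
rewrite -(opprB (f n)) -(opprB (f n.+1)) (@axis_crossN _ k)//; last 3 first.
- have := step n (ltnSn n); rewrite !mdist_plane /= !opprB.
  by rewrite !addrA !subrK.
- exact: far.
- exact: far.
by rewrite -!addbA; congr (_ (+) _); do ?case: (upper _); case: axis_cross.
Qed.

(** Up to terms that depend on the end points alone, this is the winding number mod 2
   of the difference of the two chains along the boundary of their parameter
   rectangle, that is, the number mod 2 of their crossings. *)
Definition linked_parity f n g m : bool :=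
  cross_parity f n (g 0%N) (+) cross_parity f n (g m) (+)
  cross_parity g m (f n) (+) cross_parity g m (f 0%N).

(** Two chains at a distance that is large with respect to their steps have a
   difference that never comes near the origin, so every cell of the parameter grid
   is balanced by the cocycle identity. *)
Lemma unlinked f n g m k : 0 < k ->
  (forall s t, (s <= n)%N -> (t <= m)%N -> 2 * k <= mdist (f s) (g t)) ->
  (forall s, (s < n)%N -> mdist (f s) (f s.+1) < k) ->
  (forall t, (t < m)%N -> mdist (g t) (g t.+1) < k) ->
  linked_parity f n g m = upper (g 0%N - f n) (+) upper (g m - f n) (+)
    upper (g 0%N - f 0%N) (+) upper (g m - f 0%N).
Proof.
move=> k0 fg stepf stepg; have k20 : 0 < 2 * k by rewrite mulr_gt0.
have far s t : (s <= n)%N -> (t <= m)%N -> far_from0 (2 * k) (f s - g t).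
  by move=> sn tm; have := fg s t sn tm; rewrite mdist_plane le_max.
have far' s t : (s <= n)%N -> (t <= m)%N -> far_from0 (2 * k) (g t - f s).
  by move=> sn tm; rewrite -opprB far_from0N; exact: far.
have klt a b : mdist a b < k -> mdist a b < 2 * k by lra.
pose H s t := axis_cross (f s - g t) (f s.+1 - g t).
pose V s t := axis_cross (f s - g t) (f s - g t.+1).
have cell s t : (s < n)%N -> (t < m)%N -> H s t (+) V s.+1 t = V s t (+) H s t.+1.
  move=> sn tm; rewrite /H /V.
  have sn' := ltnW sn; have tm' := ltnW tm.
  have diag : mdist (f s - g t) (f s.+1 - g t.+1) < 2 * k.
    have := metric_triangle (f s - g t) (f s.+1 - g t) (f s.+1 - g t.+1).
    by rewrite mdist_subr mdist_subl; have := stepf s sn; have := stepg t tm; lra.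
  rewrite (@axis_cross_cocycle _ (2 * k))//; rewrite ?mdist_subr ?mdist_subl;
    try (by apply: klt; auto); try (by apply: far).
  rewrite (@axis_cross_cocycle _ (2 * k))//; rewrite ?mdist_subr ?mdist_subl;
    try (by apply: klt; auto); try (by apply: far).
have := grid_boundary cell; rewrite /H /V.
rewrite (@cross_parity_rev g m (f n) (2 * k))//; last 2 first.
- by move=> t tm; exact: far'.
- by move=> t tm; apply: klt; auto.
rewrite (@cross_parity_rev g m (f 0%N) (2 * k))//; last 2 first.
- by move=> t tm; exact: far'.
- by move=> t tm; apply: klt; auto.
rewrite -/(cross_parity f n (g 0%N)) -/(cross_parity f n (g m)) /linked_parity.
move: (cross_parity f n (g 0%N)) (cross_parity f n (g m))
  (cross_parity g m (f n)) (cross_parity g m (f 0%N))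
  (upper (g 0%N - f n)) (upper (g m - f n)) (upper (g 0%N - f 0%N))
  (upper (g m - f 0%N)).
by move=> [] [] [] [] [] [] [] [].
Qed.

End linking.

(** The van Kampen obstruction of K_{3,3}. Here N i j k stands for the winding of the
   edge (i, j) around the vertex k of the first class, M i j l for its winding around
   the vertex l of the second class, and U, A, B record half planes of differences
   of vertices. In the sum over all pairs of independent edges the terms N, M, A
   and U appear an even number of times, whereas B j l and B l j, of which exactly one
   holds, are paired nine times. *)
Lemma linked_parity_K33 (N M : nat -> nat -> nat -> bool) (U A B : nat -> nat -> bool) :
  (forall j l, (j < 3)%N -> (l < 3)%N -> j != l -> B l j = ~~ B j l) ->
  ~ (forall i k j l, (i < k)%N -> (k < 3)%N -> (j < 3)%N -> (l < 3)%N -> j != l ->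
    N i j k (+) M i j l (+) M k l j (+) N k l i =
    U k j (+) B l j (+) A k i (+) ~~ U i l).
Proof.
move=> BN h.
pose s := [:: (0, 1); (0, 2); (1, 0); (1, 2); (2, 0); (2, 1)]%N.
have sP x : x \in s -> [/\ (x.1 < 3)%N, (x.2 < 3)%N & x.1 != x.2].
  by rewrite !inE => /or4P[|||/or3P[]] /eqP->.
pose S i := \big[addb/false]_(x <- s) M i x.1 x.2.
have S_rev i : \big[addb/false]_(x <- s) M i x.2 x.1 = S i.
  rewrite /S /s !big_cons !big_nil /=.
  move: (M i 0 1)%N (M i 1 0)%N (M i 0 2)%N (M i 2 0)%N (M i 1 2)%N (M i 2 1)%N.
  by move=> [] [] [] [] [] [].
have SS i k : (i < k)%N -> (k < 3)%N -> S i (+) S k = true.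
  move=> ik k3; rewrite -(S_rev k) /S -big_split /=.
  under eq_big_seq => x /sP[x1 x2 x12].
    have -> : M i x.1 x.2 (+) M k x.2 x.1 = (N i x.1 k (+) N k x.2 i) (+)
        ((U k x.1 (+) ~~ U i x.2) (+) (B x.2 x.1 (+) A k i)).
      have := h i k x.1 x.2 ik k3 x1 x2 x12.
      move: (N i x.1 k) (M i x.1 x.2) (M k x.2 x.1) (N k x.2 i) (U k x.1)
        (B x.2 x.1) (A k i) (U i x.2).
      by move=> [] [] [] [] [] [] [] [].
    over.
  rewrite !big_split /= /s !big_cons !big_nil /=.
  rewrite (BN 0%N 1%N)// (BN 0%N 2%N)// (BN 1%N 2%N)//.
  have -> (p0 p1 p2 q0 q1 q2 : bool) : (p0 (+) (p0 (+) (p1 (+) (p1 (+) (p2 (+) (p2 (+) false))))))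
     (+) (q1 (+) (q2 (+) (q0 (+) (q2 (+) (q0 (+) (q1 (+) false)))))) = false.
    by move: p0 p1 p2 q0 q1 q2 => [] [] [] [] [] [].
  move: (U k 0) (U k 1) (U k 2)%N (U i 0) (U i 1) (U i 2)%N => u0 u1 u2 v0 v1 v2.
  move: (B 0 1) (B 0 2) (B 1 2) (A k i) => b01 b02 b12 a.
  have -> (p0 p1 p2 q0 q1 q2 : bool) : (p0 (+) (p0 (+) (p1 (+) (p1 (+) (p2 (+) (p2 (+) false))))))
     (+) (~~ q1 (+) (~~ q2 (+) (~~ q0 (+) (~~ q2 (+) (~~ q0 (+) (~~ q1 (+) false)))))) = false.
    by move: p0 p1 p2 q0 q1 q2 => [] [] [] [] [] [].
  by move: b01 b02 b12 a => [] [] [] [].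
have := SS 0%N 1%N isT isT; have := SS 0%N 2%N isT isT; have := SS 1%N 2%N isT isT.
by case: (S 0%N); case: (S 1%N); case: (S 2%N).
Qed.

Lemma finite_uniform (R : realType) (I : eqType) (s : seq I) (P : I -> R -> Prop) :
  (forall i d d', d' <= d -> P i d -> P i d') ->
  (forall i, i \in s -> exists2 d, 0 < d & P i d) ->
  exists2 d, 0 < d & forall i, i \in s -> P i d.
Proof.
move=> Pmono; elim: s => [|i s IH] h; first by exists 1.
have [d d0 hd] := IH (fun j js => h j (@mem_behead _ (i :: s) j js)).
have [e e0 he] := h i (mem_head i s).
exists (Num.min d e); first by rewrite lt_min d0.
move=> j; rewrite inE => /orP[/eqP->|js].
  by apply: Pmono he; rewrite ge_min lexx orbT.
by apply: Pmono (hd j js); rewrite ge_min lexx.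
Qed.

Section K33.
Context {R : realType}.

(** Continua can be replaced by chains whose steps are small with respect to the
   distances between independent edges. *)
Lemma planar_K33 (a b : nat -> R * R) (E : nat -> nat -> set (R * R)) :
  (forall i j, (i < 3)%N -> (j < 3)%N ->
    [/\ connected (E i j), compact (E i j), E i j (a i) & E i j (b j)]) ->
  ~ (forall i j k l, (i < 3)%N -> (j < 3)%N -> (k < 3)%N -> (l < 3)%N ->
    i != k -> j != l -> E i j `&` E k l = set0).
Proof.
move=> hE disj.
have [d d0 dE] : exists2 d : R, 0 < d & forall x : 'I_3 * 'I_3 * ('I_3 * 'I_3),
    x \in enum {: 'I_3 * 'I_3 * ('I_3 * 'I_3)} ->
    x.1.1 != x.2.1 -> x.1.2 != x.2.2 ->
    forall p q, E x.1.1 x.1.2 p -> E x.2.1 x.2.2 q -> d <= mdist p q.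
  apply: finite_uniform => [x e e' ee h h1 h2 p q Ep Eq|x _].
    by rewrite (le_trans ee)//; exact: h.
  have [h1|h1] := eqVneq x.1.1 x.2.1; first by exists 1 => //; rewrite h1 eqxx.
  have [h2|h2] := eqVneq x.1.2 x.2.2; first by exists 1 => //; rewrite h2 eqxx.
  have [_ k1 _ _] := hE _ _ (ltn_ord x.1.1) (ltn_ord x.1.2).
  have [_ k2 _ _] := hE _ _ (ltn_ord x.2.1) (ltn_ord x.2.2).
  have [|e e0 h] := disjoint_mdist k1 (compact_closed_metric k2).
    exact: disj.
  by exists e.
have sep i j k l : (i < 3)%N -> (j < 3)%N -> (k < 3)%N -> (l < 3)%N ->
    i != k -> j != l -> forall p q, E i j p -> E k l q -> d <= mdist p q.
  move=> i3 j3 k3 l3 ik jl.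
  exact: (dE (Ordinal i3, Ordinal j3, (Ordinal k3, Ordinal l3)) (mem_enum _ _) ik jl).
have chain (x : nat * nat) : exists y : nat * (nat -> R * R),
    (x.1 < 3)%N -> (x.2 < 3)%N -> [/\ y.2 0%N = a x.1, y.2 y.1 = b x.2,
      forall s, E x.1 x.2 (y.2 s) &
      forall s, (s < y.1)%N -> mdist (y.2 s) (y.2 s.+1) < d / 2].
  case: x => i j /=; have [i3|i3] := boolP (i < 3)%N; last by exists (0%N, fun=> 0).
  have [j3|j3] := boolP (j < 3)%N; last by exists (0%N, fun=> 0).
  have [cE _ Ea Eb] := hE i j i3 j3.
  have d20 : 0 < d / 2 by rewrite divr_gt0.
  have [n [f h]] := connected_chain cE Ea Eb d20.
  by exists (n, f).
have [F hF] := choice chain.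
pose f i j := (F (i, j)).2; pose n i j := (F (i, j)).1.
apply: (@linked_parity_K33 (fun i j k => cross_parity (f i j) (n i j) (a k))
  (fun i j l => cross_parity (f i j) (n i j) (b l))
  (fun k j => upper (a k - b j)) (fun k i => upper (a k - a i))
  (fun l j => upper (b l - b j))).
  move=> j l j3 l3 jl; rewrite -upperN ?opprB// subr_eq0.
  apply/eqP => bjl; have [_ _ _ E1] := hE 0%N j isT j3.
  have [_ _ _ E2] := hE 1%N l isT l3.
  by have := sep 0%N j 1%N l isT j3 isT l3 isT jl _ _ E1 E2; rewrite bjl mdistxx leNgt d0.
move=> i k j l ik k3 j3 l3 jl; have i3 := ltn_trans ik k3.
have ik' : i != k by rewrite neq_ltn ik.
have [f0 f1 fE fs] := hF (i, j) i3 j3; have [g0 g1 gE gs] := hF (k, l) k3 l3.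
have := @unlinked R (f i j) (n i j) (f k l) (n k l) (d / 2) _ _ fs gs.
rewrite divr_gt0// => /(_ isT).
rewrite /linked_parity /f /n /= f0 f1 g0 g1 => ->.
  congr (_ (+) _); rewrite -upperN ?opprB// subr_eq0; apply/eqP => ab.
  have [_ _ E1 _] := hE i j i3 j3; have [_ _ _ E2] := hE k l k3 l3.
  by have := sep i j k l i3 j3 k3 l3 ik' jl _ _ E1 E2; rewrite ab mdistxx leNgt d0.
move=> s t _ _; rewrite mulrC divfK//; exact: (sep i j k l).
Qed.

End K33.

(** * Stereographic charts of the sphere *)

Section sphere.
Context {R : realType}.
Local Notation S2 := (riemann_sphere R).
Implicit Types (z w o : S2) (p q : R * R).

Lemma mdist_sphere z w : mdist z w = spherical_dist z w.
Proof. by []. Qed.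

Lemma dot3_stereo z : dot3 (stereo z) (stereo z) = 1.
Proof.
case: z => [[a b]|]; rewrite /dot3 /=; last by ring.
have n0 : a ^+ 2 + b ^+ 2 + 1 != 0.
  by rewrite gt_eqF// ltr_wpDl// addr_ge0// sqr_ge0.
by field.
Qed.

Lemma dot3_stereo_itv z w : -1 <= dot3 (stereo z) (stereo w) <= 1.
Proof.
move: (dot3_stereo z) (dot3_stereo w).
case: (stereo z) => [[a b] c]; case: (stereo w) => [[d e] f]; rewrite /dot3 /= => hu hv.
have := sqr_ge0 (a - d); have := sqr_ge0 (b - e); have := sqr_ge0 (c - f).
have := sqr_ge0 (a + d); have := sqr_ge0 (b + e); have := sqr_ge0 (c + f).
by move=> *; apply/andP; split; lra.
Qed.

Lemma cos_mdist z w : cos (mdist z w) = dot3 (stereo z) (stereo w).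
Proof. by rewrite mdist_sphere /spherical_dist acosK// in_itv/= dot3_stereo_itv. Qed.

Lemma mdist_sphere_lt z w e : 0 <= e <= pi ->
  (mdist z w < e) = (cos e < dot3 (stereo z) (stereo w)).
Proof.
move=> e0pi; rewrite -cos_mdist ltr_cos ?in_itv//=.
by rewrite mdist_sphere /spherical_dist acos_ge0 ?acos_lepi ?dot3_stereo_itv.
Qed.

Lemma continuous_into_sphere (T : topologicalType) (f : T -> S2) :
  continuous (fun t => (stereo (f t)).1.1) ->
  continuous (fun t => (stereo (f t)).1.2) ->
  continuous (fun t => (stereo (f t)).2) -> continuous f.
Proof.
move=> cx cy cz t; apply/metricType_numDomainType.cvgrPdist_lt => e e0.
have m0 : 0 < Num.min e pi by rewrite lt_min e0 pi_gt0.
have mI : 0 <= Num.min e pi <= pi by rewrite ltW// ge_min lexx orbT.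
have H : (fun s => dot3 (stereo (f t)) (stereo (f s))) @ t --> dot3 (stereo (f t)) (stereo (f t)).
  by apply: cvgD; [apply: cvgD|]; apply: cvgM; try exact: cvg_cst; [exact: cx|exact: cy|exact: cz].
have : \forall s \near t, cos (Num.min e pi) < dot3 (stereo (f t)) (stereo (f s)).
  apply: (cvgr_gt _ H); rewrite dot3_stereo -cos0 ltr_cos// ?in_itv//= ?lexx ?pi_ge0//.
apply: filterS => s; rewrite -mdist_sphere_lt// => /lt_le_trans; apply.
by rewrite ge_min lexx.
Qed.

Lemma stereo_close z e : 0 < e -> exists2 d, 0 < d & forall w, mdist z w < d ->
  1 - e < dot3 (stereo z) (stereo w).
Proof.
move=> e0; have : \forall d \near (0 : R), cos d > 1 - e.
  apply: (cvgr_gt _ (@continuous_cos R 0)).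
  by rewrite cos0 ltrBlDr ltrDl.
move=> /nbhs_ballP[d d0 dP]; exists d => // w zw.
rewrite -cos_mdist; apply: dP; rewrite /ball/= sub0r normrN ger0_norm//.
exact: mdist_ge0.
Qed.

(** The hypothesis says that g is Lipschitz for the chordal distance. *)
Lemma continuous_stereo (g : R * R * R -> R) :
  (forall u v, (g u - g v) ^+ 2 <= dot3 u u - 2 * dot3 u v + dot3 v v) ->
  continuous (fun z : S2 => g (stereo z)).
Proof.
move=> hg z; apply: cvg_real_mdist => e e0.
have e20 : 0 < e ^+ 2 / 2 by rewrite divr_gt0// exprn_gt0.
have [d d0 dP] := stereo_close z e20; exists d => // w /dP h.
rewrite -ltr_sqr ?nnegrE// ?ltW// real_normK ?num_real//.
have := hg (stereo z) (stereo w); rewrite !dot3_stereo; lra.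
Qed.

Lemma continuous_stereo1 : continuous (fun z : S2 => (stereo z).1.1).
Proof.
apply: (@continuous_stereo (fun u => u.1.1)) => -[[a b] c] [[a' b'] c']; rewrite /dot3/=.
have := sqr_ge0 (b - b'); have := sqr_ge0 (c - c'); lra.
Qed.

Lemma continuous_stereo2 : continuous (fun z : S2 => (stereo z).1.2).
Proof.
apply: (@continuous_stereo (fun u => u.1.2)) => -[[a b] c] [[a' b'] c']; rewrite /dot3/=.
have := sqr_ge0 (a - a'); have := sqr_ge0 (c - c'); lra.
Qed.

Lemma continuous_stereo3 : continuous (fun z : S2 => (stereo z).2).
Proof.
apply: (@continuous_stereo (fun u => u.2)) => -[[a b] c] [[a' b'] c']; rewrite /dot3/=.
have := sqr_ge0 (a - a'); have := sqr_ge0 (b - b'); lra.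
Qed.

(** The inverse of the stereographic projection from o. For a finite pole c this is
   the inversion w / |w|^2 followed by the translation by c. *)
Definition chart_inv o p : S2 :=
  if o is Some (a +i* b)%C then
    if p == 0 then None else
    let m := p.1 ^+ 2 + p.2 ^+ 2 in Some ((a + p.1 / m) +i* (b + p.2 / m))%C
  else Some (p.1 +i* p.2)%C.

(** In terms of the point (x, y, h) of the unit sphere of R^3 the formula for a finite
   pole extends continuously to the point at infinity, because the common factor
   1 - h has been cancelled. *)
Definition chart o z : R * R :=
  let: (x, y, h) := stereo z in
  if o is Some (a +i* b)%C then
    let G := 1 + h - 2 * (a * x + b * y) + (a ^+ 2 + b ^+ 2) * (1 - h) in
    ((x - a * (1 - h)) / G, (y - b * (1 - h)) / G)
  else (x / (1 - h), y / (1 - h)).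

Let sqr1_neq0 (a b : R) : a ^+ 2 + b ^+ 2 + 1 != 0.
Proof. by rewrite gt_eqF// ltr_wpDl// addr_ge0// sqr_ge0. Qed.

Let sqr_neq0 (a b : R) : (a, b) != 0 -> a ^+ 2 + b ^+ 2 != 0.
Proof.
rewrite -[0]/(0, 0) xpair_eqE negb_and -!(sqrf_eq0 a) -!(sqrf_eq0 b) => /orP[] h.
  by rewrite gt_eqF// ltr_pwDl ?sqr_ge0// lt_def h sqr_ge0.
by rewrite gt_eqF// ltr_wpDl ?sqr_ge0// lt_def h sqr_ge0.
Qed.

Lemma chart_inv_neq o p : chart_inv o p <> o.
Proof.
case: o => [[a b]|] //=; case: eqP => // /eqP; case: p => u v p0 [].
move=> /eqP; rewrite -subr_eq0 addrAC subrr add0r mulf_eq0 invr_eq0.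
rewrite (negbTE (sqr_neq0 p0)) orbF => /eqP u0.
move=> /eqP; rewrite -subr_eq0 addrAC subrr add0r mulf_eq0 invr_eq0.
rewrite (negbTE (sqr_neq0 p0)) orbF => /eqP v0.
by move: p0; rewrite u0 v0 eqxx.
Qed.

Lemma chart_invK o z : z <> o -> chart_inv o (chart o z) = z.
Proof.
have E (a b : R) : 1 - (a ^+ 2 + b ^+ 2 - 1) / (a ^+ 2 + b ^+ 2 + 1) = 2 / (a ^+ 2 + b ^+ 2 + 1).
  by field; exact: sqr1_neq0.
case: o => [[c d]|]; case: z => [[a b]|] zo; last 3 first.
- by rewrite /chart /= subrr !mulr0 !subr0 !mul0r eqxx.
- by rewrite /chart /= E; congr (Some (_ +i* _)%C); field; exact: sqr1_neq0.
- by [].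
have n1 := sqr1_neq0 a b.
have zo' : (a - c, b - d) != 0.
  apply/eqP => -[/eqP + /eqP]; rewrite !subr_eq0 => /eqP ac /eqP bd.
  by apply: zo; rewrite ac bd.
have m0 := sqr_neq0 zo'.
have -> : chart (Some (c +i* d)%C) (Some (a +i* b)%C) =
    ((a - c) / ((a - c) ^+ 2 + (b - d) ^+ 2), (b - d) / ((a - c) ^+ 2 + (b - d) ^+ 2)).
  rewrite /chart /= E.
  set G := (X in (_ / X, _ / X)).
  have GE : G = 2 * ((a - c) ^+ 2 + (b - d) ^+ 2) / (a ^+ 2 + b ^+ 2 + 1).
    by rewrite /G; field.
  by rewrite GE; congr pair; field; rewrite m0 n1.
rewrite /=; case: eqP => [[/eqP + /eqP]|_].
  rewrite !mulf_eq0 !invr_eq0 (negbTE m0) !orbF => /eqP a0 /eqP b0.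
  by move: zo'; rewrite a0 b0 eqxx.
by congr (Some (_ +i* _)%C); field; rewrite m0.
Qed.

Lemma stereo_chart_inv_Some (c d : R) p :
  let m := p.1 ^+ 2 + p.2 ^+ 2 in
  let H := m * (c ^+ 2 + d ^+ 2 + 1) + 2 * (c * p.1 + d * p.2) + 1 in
  H != 0 /\ stereo (chart_inv (Some (c +i* d)%C) p) =
    (2 * (c * m + p.1) / H, 2 * (d * m + p.2) / H, 1 - 2 * m / H).
Proof.
case: p => u v m H; rewrite /= in m H *.
have [[u0 v0]|p0] := eqVneq (u, v) 0.
  rewrite /H /m u0 v0 expr0n /= !mulr0 !addr0 !mul0r !mulr0 !add0r; split.
    exact: oner_neq0.
  by rewrite mul0r subr0.
have m0 : m != 0 by exact: sqr_neq0.
have n1 := sqr1_neq0 (c + u / m) (d + v / m).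
have HE : H = m * ((c + u / m) ^+ 2 + (d + v / m) ^+ 2 + 1).
  by rewrite /H /m; field; exact: m0.
have H0 : H != 0 by rewrite HE mulf_neq0.
have n2 : (c * m + u) ^+ 2 + (d * m + v) ^+ 2 + m ^+ 2 != 0.
  have -> : (c * m + u) ^+ 2 + (d * m + v) ^+ 2 + m ^+ 2 =
      m ^+ 2 * ((c + u / m) ^+ 2 + (d + v / m) ^+ 2 + 1) by field.
  by rewrite mulf_neq0// expf_neq0.
by split => //; rewrite HE /= -/m; congr (_, _, _); field; rewrite m0 n2.
Qed.

Lemma chart_inv_continuous o : continuous (chart_inv o).
Proof.
have c1 : continuous (fun p : R * R => p.1) by move=> p; exact: cvg_fst.
have c2 : continuous (fun p : R * R => p.2) by move=> p; exact: cvg_snd.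
have cM (f g : R * R -> R) : continuous f -> continuous g -> continuous (fun p => f p * g p).
  by move=> cf cg p; apply: cvgM; [exact: cf|exact: cg].
have cD (f g : R * R -> R) : continuous f -> continuous g -> continuous (fun p => f p + g p).
  by move=> cf cg p; apply: cvgD; [exact: cf|exact: cg].
have cN (f : R * R -> R) : continuous f -> continuous (fun p => - f p).
  by move=> cf p; apply: cvgN; exact: cf.
have cC (x : R) : continuous (fun _ : R * R => x) by move=> p; exact: cvg_cst.
have cdiv (f g : R * R -> R) : continuous f -> continuous g -> (forall p, g p != 0) ->
    continuous (fun p => f p / g p).
  move=> cf cg g0 p; apply: cvgM; first exact: cf.
  by apply: cvgV; [exact: g0|exact: cg].
have cm : continuous (fun p : R * R => p.1 ^+ 2 + p.2 ^+ 2).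
  by apply: (cD); apply: (cM).
case: o => [[c d]|]; last first.
  have cn : continuous (fun p : R * R => p.1 ^+ 2 + p.2 ^+ 2 + 1) by apply: (cD).
  apply: continuous_into_sphere => /=; apply: (cdiv) => //; try by move=> p; exact: sqr1_neq0.
  - exact: cM.
  - exact: cM.
  - exact: cD.
have H0 p := (stereo_chart_inv_Some c d p).1.
have HE p := (stereo_chart_inv_Some c d p).2.
have cH : continuous (fun p : R * R => (p.1 ^+ 2 + p.2 ^+ 2) * (c ^+ 2 + d ^+ 2 + 1)
    + 2 * (c * p.1 + d * p.2) + 1).
  apply: (cD) => //; apply: (cD); first exact: cM.
  by apply: (cM) => //; apply: (cD); exact: cM.
apply: continuous_into_sphere; under eq_fun => p do rewrite HE /=; rewrite -/(continuous _).
- apply: (cdiv) => //; apply: (cM) => //; apply: (cD) => //; exact: cM.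
- apply: (cdiv) => //; apply: (cM) => //; apply: (cD) => //; exact: cM.
- apply: (cD) => //; apply: (cN); apply: (cdiv) => //; exact: cM.
Qed.

Lemma chart_NoneE z : chart None z =
  ((stereo z).1.1 / (1 - (stereo z).2), (stereo z).1.2 / (1 - (stereo z).2)).
Proof. by rewrite /chart; case: (stereo z) => [[x y] h]. Qed.

Let den (c d : R) z := 1 + (stereo z).2 - 2 * (c * (stereo z).1.1 + d * (stereo z).1.2)
  + (c ^+ 2 + d ^+ 2) * (1 - (stereo z).2).

Lemma chart_SomeE c d z : chart (Some (c +i* d)%C) z =
  (((stereo z).1.1 - c * (1 - (stereo z).2)) / den c d z,
   ((stereo z).1.2 - d * (1 - (stereo z).2)) / den c d z).
Proof. by rewrite /chart /den; case: (stereo z) => [[x y] h]. Qed.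

Let cvg_chart_None (T : topologicalType) (t : T) (x y h : T -> R) :
  {for t, continuous x} -> {for t, continuous y} -> {for t, continuous h} ->
  1 - h t != 0 -> {for t, continuous (fun s => (x s / (1 - h s), y s / (1 - h s)))}.
Proof.
move=> cx cy ch h0.
have ch' : (fun s => 1 - h s) @ t --> 1 - h t by apply: cvgB => //; exact: cvg_cst.
have hx : (fun s => x s / (1 - h s)) @ t --> x t / (1 - h t).
  by apply: cvgM => //; exact: cvgV.
have hy : (fun s => y s / (1 - h s)) @ t --> y t / (1 - h t).
  by apply: cvgM => //; exact: cvgV.
exact: (cvg_pair hx hy).
Qed.

Let cvg_chart_Some (T : topologicalType) (t : T) (x y h : T -> R) (c d : R) :
  let G s := 1 + h s - 2 * (c * x s + d * y s) + (c ^+ 2 + d ^+ 2) * (1 - h s) in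
  {for t, continuous x} -> {for t, continuous y} -> {for t, continuous h} ->
  G t != 0 -> {for t, continuous (fun s =>
    ((x s - c * (1 - h s)) / G s, (y s - d * (1 - h s)) / G s))}.
Proof.
move=> G cx cy ch G0.
have ch' : (fun s => 1 - h s) @ t --> 1 - h t by apply: cvgB => //; exact: cvg_cst.
have cG : G @ t --> G t.
  apply: cvgD; last by apply: cvgM => //; exact: cvg_cst.
  apply: cvgB; first by apply: cvgD => //; exact: cvg_cst.
  by apply: cvgM; [exact: cvg_cst|apply: cvgD; apply: cvgM => //; exact: cvg_cst].
have hx : (fun s => (x s - c * (1 - h s)) / G s) @ t --> (x t - c * (1 - h t)) / G t.
  apply: cvgM; last exact: cvgV.
  by apply: cvgB => //; apply: cvgM => //; exact: cvg_cst.
have hy : (fun s => (y s - d * (1 - h s)) / G s) @ t --> (y t - d * (1 - h t)) / G t.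
  apply: cvgM; last exact: cvgV.
  by apply: cvgB => //; apply: cvgM => //; exact: cvg_cst.
exact: (cvg_pair hx hy).
Qed.

Lemma chart_continuous o z : z <> o -> {for z, continuous (chart o)}.
Proof.
have c1 := @continuous_stereo1 z; have c2 := @continuous_stereo2 z.
have c3 := @continuous_stereo3 z.
case: o => [[c d]|] zo; last first.
  have h0 : 1 - (stereo z).2 != 0.
    case: z zo {c1 c2 c3} => [[a b]|] // _; rewrite /=.
    have -> : 1 - (a ^+ 2 + b ^+ 2 - 1) / (a ^+ 2 + b ^+ 2 + 1) = 2 / (a ^+ 2 + b ^+ 2 + 1).
      by field; exact: sqr1_neq0.
    by rewrite mulf_neq0// invr_eq0 sqr1_neq0.
  rewrite (funext chart_NoneE); exact: cvg_chart_None.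
have G0 : den c d z != 0.
  rewrite /den; case: z zo {c1 c2 c3} => [[a b]|] zo; rewrite /=; last first.
    rewrite (_ : _ + _ = 2) ?pnatr_eq0//; ring.
  set G := (X in X != 0).
  have -> : G = 2 * ((a - c) ^+ 2 + (b - d) ^+ 2) / (a ^+ 2 + b ^+ 2 + 1).
    by rewrite /G; field; exact: sqr1_neq0.
  rewrite !mulf_neq0// ?invr_eq0 ?sqr1_neq0//; apply: sqr_neq0.
  apply/eqP => -[/eqP + /eqP]; rewrite !subr_eq0 => /eqP ac /eqP bd.
  by apply: zo; rewrite ac bd.
rewrite (funext (chart_SomeE c d)); exact: cvg_chart_Some.
Qed.

Lemma chartK o : cancel (chart_inv o) (chart o).
Proof.
case: o => [[c d]|] p; last first.
  rewrite chart_NoneE /=; have n0 := sqr1_neq0 p.1 p.2.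
  case: p n0 => a b /= n0.
  have -> : 1 - (a ^+ 2 + b ^+ 2 - 1) / (a ^+ 2 + b ^+ 2 + 1) = 2 / (a ^+ 2 + b ^+ 2 + 1) by field.
  by congr pair; field.
have [H0 E] := stereo_chart_inv_Some c d p.
rewrite chart_SomeE /den E /=; move: H0 {E}; set m := _ + p.2 ^+ 2.
set H := _ + 1 => H0.
have -> : 1 + (1 - 2 * m / H) - 2 * (c * (2 * (c * m + p.1) / H) + d * (2 * (d * m + p.2) / H)) +
  (c ^+ 2 + d ^+ 2) * (1 - (1 - 2 * m / H)) = 2 / H.
  by rewrite /H; field; exact: H0.
by rewrite [RHS]surjective_pairing; congr pair; field.
Qed.

End sphere.

(** * Cocycles and unicoherence *)

Section cocycles.
Context {R : realType} {T : metricType R}.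
Implicit Types (A B X Y : set T) (c : T -> T -> bool) (d e : R) (x y z : T).

Lemma compact_unif_continuous {U : metricType R} A (f : T -> U) e :
  compact A -> (forall x, A x -> {for x, continuous f}) -> 0 < e ->
  exists2 d, 0 < d & forall x y, A x -> A y -> mdist x y < d ->
    mdist (f x) (f y) < e.
Proof.
move=> kA cf e0.
have [||d d0 h] := @compact_uniform _ _ A
  (fun x d => forall y, A y -> mdist x y < d -> mdist (f x) (f y) < e) kA.
- by move=> x d d' dd h y Ay xy; apply: h => //; exact: lt_le_trans dd.
- move=> x Ax; have e20 : 0 < e / 2 by rewrite divr_gt0.
  have : nbhs (f x) (ball (f x) (e / 2)).
    by apply/nbhs_mdist; exists (e / 2) => // u /ballP.
  move=> /(cf x Ax)/nbhs_mdist[d d0 dP].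
  exists (d / 2) => [|y Ay xy z Az yz]; first by rewrite divr_gt0.
  have /ballP fy : ball (f x) (e / 2) (f y) by apply: dP; lra.
  have /ballP fz : ball (f x) (e / 2) (f z).
    by apply: dP; have := metric_triangle x y z; lra.
  have := metric_triangle (f y) (f x) (f z); rewrite (metric_sym (f y) (f x)); lra.
by exists d => // x y Ax; exact: h.
Qed.

Lemma near_intersection A B e : compact A -> compact B -> 0 < e ->
  exists2 d, 0 < d & forall x y, A x -> B y -> mdist x y < d ->
    exists2 z, A z /\ B z & mdist x z < e /\ mdist y z < e.
Proof.
move=> kA kB e0; have clB := compact_closed_metric kB; have e20 : 0 < e / 2 by rewrite divr_gt0.
pose O := \bigcup_(z in A `&` B) [set y | mdist z y < e / 2].
have oO : open O by apply: bigcup_open => z _; exact: open_mdist_lt.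
have kAO : compact (A `\` O).
  by apply: compact_closedI => //; exact: open_closedC.
have [|d d0 dP] := disjoint_mdist kAO clB.
  rewrite -subset0 => z [[Az nO] Bz]; apply: nO; exists z => //=.
  by rewrite mdistxx.
exists (Num.min d (e / 2)) => [|x y Ax By]; first by rewrite lt_min d0.
rewrite lt_min => /andP[xyd xye].
have [[z [Az Bz] /= zx]|nO] := pselect (O x).
  exists z => //; have := metric_triangle y x z.
  rewrite (metric_sym y x) (metric_sym x z); lra.
by have := dP x y (conj Ax nO) By; rewrite leNgt xyd.
Qed.

(** A cocycle mod 2 at scale d is a discrete double covering; a potential is a
   trivialization of it at some smaller scale. *)
Definition cocycle d c := forall x y z, mdist x y < d -> mdist y z < d ->
  mdist x z < d -> c x y (+) c y z = c x z.

Definition potential A c (h : T -> bool) := exists2 d, 0 < d &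
  forall x y, A x -> A y -> mdist x y < d -> h x (+) h y = c x y.

Definition cocycle_trivial A := forall d c, 0 < d -> cocycle d c ->
  exists h, potential A c h.

Lemma cocyclexx d c x : 0 < d -> cocycle d c -> c x x = false.
Proof. by move=> d0 /(_ x x x); rewrite mdistxx => /(_ d0 d0 d0); case: (c x x). Qed.

(** Potentials on A and B differ by a constant on the connected intersection. After
   one of them is changed by this constant they agree on steps from A to B, since
   such a step is close to a point of the intersection. *)
Lemma cocycle_trivialU A B : compact A -> compact B -> connected (A `&` B) ->
  A `&` B !=set0 -> cocycle_trivial A -> cocycle_trivial B ->
  cocycle_trivial (A `|` B).
Proof.
move=> kA kB cAB [p [Ap Bp]] tA tB d c d0 cc.
have [h [dA dA0 hA]] := tA d c d0 cc; have [k [dB dB0 kB']] := tB d c d0 cc.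
have hk z : A z -> B z -> h z (+) k z = h p (+) k p.
  move=> Az Bz; apply: (@connected_spread _ (A `&` B)
    (fun z => h z (+) k z = h p (+) k p) p cAB) => // w [Aw Bw].
  exists [set u | mdist w u < Num.min dA dB].
    by apply/nbhs_mdist; exists (Num.min dA dB); rewrite // lt_min dA0.
  move=> u [Au Bu] /=; rewrite lt_min => /andP[wuA wuB].
  have := hA w u Aw Au wuA; have := kB' w u Bw Bu wuB.
  by case: (h w) (h u) (k w) (k u) (c w u) => [] [] [] [] [].
pose e := Num.min (d / 2) (Num.min dA dB).
have e0 : 0 < e by rewrite !lt_min divr_gt0// dA0.
have [ed eA eB] : [/\ e <= d / 2, e <= dA & e <= dB].
  by rewrite /e; split; rewrite !ge_min lexx ?orbT.
have [f f0 near] := near_intersection kA kB e0.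
pose g z := if `[< A z >] then h z else k z (+) (h p (+) k p).
have gA z : A z -> g z = h z by move=> Az; rewrite /g asboolT.
have gB z : B z -> g z = k z (+) (h p (+) k p).
  move=> Bz; rewrite /g; case: asboolP => // Az; rewrite -(hk z Az Bz).
  by case: (h z) (k z) => [] [].
have gAB x y : A x -> B y -> mdist x y < Num.min e f -> g x (+) g y = c x y.
  move=> Ax By; rewrite lt_min => /andP[xye xyf].
  have [z [Az Bz] [xz yz]] := near x y Ax By xyf.
  have := hA x z Ax Az (lt_le_trans xz eA).
  have zy : mdist z y < e by rewrite metric_sym.
  have := kB' z y Bz By (lt_le_trans zy eB).
  rewrite -(cc x z y); [|lra..].
  rewrite (gA x Ax) (gB y By) -(hk z Az Bz) => <- <-.
  by case: (h x) (h z) (k z) (k y) => [] [] [] [].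
exists g, (Num.min e f); first by rewrite lt_min e0.
move=> x y ABx ABy xy; have := xy; rewrite lt_min => /andP[xye xyf].
case: ABx ABy => [Ax|Bx] [Ay|By].
- by rewrite !gA//; apply: hA => //; exact: lt_le_trans eA.
- exact: gAB.
- rewrite addbC gAB//; last by rewrite metric_sym.
  have := cc x y x; rewrite mdistxx d0 (metric_sym y x) (cocyclexx x d0 cc).
  have -> : mdist x y < d by lra.
  by move=> /(_ isT isT isT); case: (c x y) (c y x) => [] [].
- rewrite !gB// addbACA addbb addbF; apply: kB' => //; exact: lt_le_trans eB.
Qed.

(** Suppose that the intersection of X and Y splits into E false and E true. A step
   between X and its complement takes place near one of these two parts; counting
   those near E true defines a cocycle. A potential h of it is constant on X, while
   on Y it becomes constant after it is changed on X near E true. Comparing a point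
   of E false with a point of E true gives a contradiction. *)
Lemma cocycle_trivial_unicoherent X Y : compact [set: T] -> cocycle_trivial setT ->
  closed X -> closed Y -> connected X -> connected Y -> X `|` Y = setT ->
  connected (X `&` Y).
Proof.
move=> kT tT clX clY cX cY XY; apply/connectedP => E [E0 EU sE].
have clE b : closed (E b).
  have clXY : closed (X `&` Y) by exact: closedI.
  case: b; last exact: separated_closed clXY EU sE.
  by apply: separated_closed clXY _ _; last rewrite separatedC; rewrite ?EU 1?setUC.
have kX : compact X by exact: subclosed_compact clX kT _.
have kY : compact Y by exact: subclosed_compact clY kT _.
have kE : compact (E false) by exact: subclosed_compact (clE false) kT _.
have [d0 d00 dP] := disjoint_mdist kE (clE true) (separated_disjoint sE).
pose e := d0 / 5; have e0 : 0 < e by rewrite divr_gt0.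
have [d d_gt0 near] := near_intersection kX kY e0.
(* A step between X and its complement has a point of the intersection within e of
   both ends, so the corners of a small triangle with this step as a side are within
   2e of that point; and 4e is less than the distance between the two parts. *)
pose nb x := `[< exists2 b, E true b & mdist x b < 2 * e >].
have nbT x b : E true b -> mdist x b < 2 * e -> nb x.
  by move=> Eb xb; apply/asboolP; exists b.
have nbF x a : E false a -> mdist x a < 2 * e -> nb x = false.
  move=> Ea xa; apply/asboolPn => -[b Eb xb]; have := dP a b Ea Eb.
  have := metric_triangle a x b; rewrite (metric_sym a x) /e in xa xb *; lra.
pose inX x := `[< X x >].
have YX x : ~ X x -> Y x.
  by move=> nX; have : [set: T] x by []; rewrite -XY => -[].
pose f := Num.min d e.
have f0 : 0 < f by rewrite lt_min d_gt0.
have mixed x y : mdist x y < f -> inX x != inX y ->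
    exists b, forall z, mdist x z < f -> mdist y z < f -> nb z = b.
  move=> xyf xy; suff [z Ez [xz yz]] : exists2 z, X z /\ Y z &
      mdist x z < e /\ mdist y z < e.
    have : (X `&` Y) z by []. rewrite EU => -[Ez'|Ez']; [exists false|exists true].
      move=> w; rewrite !lt_min => /andP[_ xw] _; apply: (nbF w z) => //.
      have := metric_triangle w x z; rewrite (metric_sym w x); lra.
    move=> w; rewrite !lt_min => /andP[_ xw] _; apply: (nbT w z) => //.
    have := metric_triangle w x z; rewrite (metric_sym w x); lra.
  have [xyd _] : mdist x y < d /\ mdist x y < e by move: xyf; rewrite lt_min => /andP.
  move: xy; rewrite /inX; case: asboolP => Xx; case: asboolP => Xy // _.
    exact: near Xx (YX y Xy) xyd.
  have [|z ? []] := near y x Xy (YX x Xx); first by rewrite metric_sym.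
  by exists z.
pose c x y := (inX x (+) inX y) && nb x.
have cc : cocycle f c.
  move=> x y z xy yz xz; rewrite /c.
  have [yx zy zx] : [/\ mdist y x < f, mdist z y < f & mdist z x < f].
    by rewrite (metric_sym y) (metric_sym z) (metric_sym z x).
  have [b nbb] : exists b, inX x != inX y \/ inX y != inX z -> nb x = b /\ nb y = b.
    have [h|h] := boolP (inX x != inX y).
      have [b hb] := mixed x y xy h; exists b => _.
      by split; apply: hb; rewrite ?mdistxx.
    have [h'|h'] := boolP (inX y != inX z).
      have [b hb] := mixed y z yz h'; exists b => _.
      by split; apply: hb; rewrite ?mdistxx.
    by exists true => -[].
  have [h|] := boolP ((inX x != inX y) || (inX y != inX z)).
    have [-> ->] := nbb (orP h).
    by case: (inX x) (inX y) (inX z) b {nbb} => [] [] [] [].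
  by rewrite negb_or !negbK => /andP[/eqP-> /eqP->]; rewrite addbb.
have [h [g g0 hP]] := tT f c f0 cc.
have [a Ea] := E0 false; have [b Eb] := E0 true.
have [Xa Ya] : (X `&` Y) a by rewrite EU; left.
have [Xb Yb] : (X `&` Y) b by rewrite EU; right.
have hX : h b = h a.
  apply: (@connected_spread _ X (fun z => h z = h a) a cX) => // z Xz.
  exists [set w | mdist z w < g]; first by apply/nbhs_mdist; exists g.
  move=> w Xw /= zw; have := hP z w I I zw.
  by rewrite /c /inX !asboolT//=; case: (h z) (h w) (h a) => [] [] [].
pose k y := h y (+) (inX y && nb y).
have : k b = k a.
  apply: (@connected_spread _ Y (fun z => k z = k a) a cY) => // z Yz.
  exists [set w | mdist z w < Num.min f g].
    by apply/nbhs_mdist; exists (Num.min f g); rewrite // lt_min f0.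
  move=> w Yw /=; rewrite lt_min => /andP[zwf zwg].
  suff -> : k z = k w by [].
  have := hP z w I I zwg; rewrite /c /k.
  have [zw|zw] := boolP (inX z != inX w).
    have [b' hb] := mixed z w zwf zw.
    rewrite (hb z) ?mdistxx// ?(metric_sym w)// (hb w) ?mdistxx//.
    by case: (h z) (h w) (inX z) (inX w) b' zw {hb} => [] [] [] [] [].
  rewrite (eqP (negbNE zw)) addbb /=; case: (boolP (inX w)) => [/asboolP Xw|_] /=; last first.
    by case: (h z) (h w) => [] [].
  have Xz : X z by move: zw; rewrite negbK /inX => /eqP; rewrite (asboolT Xw) => /asboolP.
  have -> : nb z = nb w.
    have e20 : 0 < 2 * e by rewrite mulr_gt0.
    have zwe : mdist z w < 2 * e by move: zwf; rewrite lt_min => /andP[_]; lra.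
    have : (X `&` Y) z by []. rewrite EU => -[Ez|Ez].
      by rewrite (nbF z z) ?mdistxx// (nbF w z)// metric_sym.
    by rewrite (nbT z z) ?mdistxx// (nbT w z)// metric_sym.
  by case: (h z) (h w) (nb w) => [] [] [].
rewrite /k /inX !asboolT//= hX (nbT b b) ?mdistxx ?mulr_gt0//.
by rewrite (nbF a a) ?mdistxx ?mulr_gt0//; case: (h a).
Qed.

End cocycles.

(** * Topology of the sphere *)

Section sphere_topology.
Context {R : realType}.
Local Notation S2 := (riemann_sphere R).
Implicit Types (z w o : S2) (p q : R * R).

Definition scale (t : R) p : R * R := (t * p.1, t * p.2).

Lemma segment_connected_image (f : R -> R * R) (a b : R) : continuous f ->
  connected (f @` `[a, b]).
Proof.
move=> cf; apply: connected_continuous_connected; first exact: segment_connected.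
exact: continuous_subspaceT.
Qed.

Lemma star_connected (A : set (R * R)) q :
  (forall p t, A p -> 0 <= t <= 1 -> A (q + scale t (p - q))) -> connected A.
Proof.
move=> starA; have [[p0 Ap0]|A0] := pselect (A !=set0); last first.
  rewrite (_ : A = set0); first exact: connected0.
  by rewrite -subset0 => p Ap; apply: A0; exists p.
pose seg p := (fun t => q + scale t (p - q)) @` `[0, 1].
have -> : A = \bigcup_(p in A) seg p.
  apply/seteqP; split=> p.
    move=> Ap; exists p => //; exists 1; first by rewrite /= in_itv/= ler01 lexx.
    by rewrite /scale !mul1r -surjective_pairing addrC subrK.
  by move=> [r Ar [t /=]]; rewrite in_itv/= => t01 <-; exact: starA.
apply: bigcup_connected.
  exists q => p Ap; exists 0; first by rewrite /= in_itv/= lexx ler01.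
  by rewrite /scale !mul0r -[(0, 0)]/(0 : R * R) addr0.
move=> p Ap; apply: segment_connected_image => t.
have c (x y : R) : (fun t => x + t * y) @ t --> x + t * y.
  by apply: cvgD; [exact: cvg_cst|apply: cvgM; [exact: cvg_id|exact: cvg_cst]].
exact: (cvg_pair (c q.1 (p - q).1) (c q.2 (p - q).2)).
Qed.

Lemma plane_ball_connected p (r : R) : connected [set q | mdist p q < r].
Proof.
apply: (@star_connected _ p) => q t /=; rewrite !mdist_plane !gt_max => /andP[h1 h2] /andP[t0 t1].
have aux (x y : R) : `|x - y| < r -> `|x - (x + t * (y - x))| < r.
  move=> xy; rewrite opprD addrA subrr sub0r normrN normrM (ger0_norm t0) (distrC y).
  by rewrite (le_lt_trans _ xy)// -[leRHS]mul1r ler_wpM2r.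
by rewrite !aux.
Qed.

Lemma range_chart_inv o : range (chart_inv o) = ~` [set o].
Proof.
apply/seteqP; split => z; first by move=> [p _ <-]; exact: chart_inv_neq.
by move=> zo; exists (chart o z) => //; exact: chart_invK.
Qed.

Lemma connected_image_chart_inv o (A : set (R * R)) : connected A ->
  connected (chart_inv o @` A).
Proof.
move=> cA; apply: connected_continuous_connected => //.
by apply: continuous_subspaceT; exact: chart_inv_continuous.
Qed.

Lemma sphere_minus_point_connected o : connected (~` [set o]).
Proof.
rewrite -range_chart_inv; apply: connected_image_chart_inv.
by apply: (@star_connected _ 0).
Qed.

Lemma exists_neq_sphere z : exists o, o <> z.
Proof. by case: z => [z|]; [exists None|exists (Some 0)]. Qed.

Lemma sphere_connected : connected [set: S2].
Proof.
have -> : [set: S2] = ~` [set None] `|` ~` [set Some 0].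
  by apply/esym/seteqP; split => // -[z|] _; [left|right].
apply: connectedU; last 2 first.
- exact: sphere_minus_point_connected.
- exact: sphere_minus_point_connected.
exists (Some 1); split => // -[] /eqP; rewrite oner_eq0//.
Qed.

Lemma sphere_locally_connected : locally_connected [set: S2].
Proof.
move=> z _ U oU Uz; have [v vz] := exists_neq_sphere z.
have zo : z <> v by move=> h; apply: vz.
have : nbhs (chart v z) (chart_inv v @^-1` U).
  apply: chart_inv_continuous; rewrite chart_invK//; exact: open_nbhs_nbhs.
move=> /nbhs_mdist[r r0 rU].
pose B := [set p | mdist (chart v z) p < r].
exists (chart_inv v @` B); split.
- rewrite openE => w [p Bp wE]; rewrite /interior.
  have wo : w <> v by rewrite -wE; exact: chart_inv_neq.
  have : nbhs (chart v w) B.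
    apply: open_nbhs_nbhs; split; first exact: open_mdist_lt.
    by rewrite -wE chartK.
  move=> /(chart_continuous wo)/nbhs_mdist[d d0 dP].
  have : 0 < Num.min d (mdist w v) by rewrite lt_min d0 mdist_gt0; exact/eqP.
  move=> m0; apply/nbhs_mdist; exists (Num.min d (mdist w v)) => // y.
  rewrite lt_min => /andP[wyd wyo]; exists (chart v y); first exact: dP.
  by rewrite chart_invK// => yo; move: wyo; rewrite yo ltxx.
- by exists (chart v z); [rewrite /B/= mdistxx|exact: chart_invK].
- by rewrite setTI => w [p /rU Up <-].
- rewrite setTI; apply: connected_image_chart_inv; exact: plane_ball_connected.
Qed.

Definition disc : set (R * R) := [set p | p.1 ^+ 2 + p.2 ^+ 2 <= 1].

Lemma disc_compact : compact disc.
Proof.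
have cl : closed disc.
  pose n p : R := p.1 ^+ 2 + p.2 ^+ 2.
  rewrite (_ : disc = n @^-1` [set x | x <= 1])//; apply: preimage_closed; last exact: closed_le.
  by move=> p _; apply: cvgD; apply: cvgM; (exact: cvg_fst || exact: cvg_snd).
have kI : compact (`[-1, 1]%classic `*` `[-1, 1]%classic : set (R * R)).
  by apply: compact_setX; exact: segment_compact.
apply: (subclosed_compact cl kI) => p; rewrite /disc/= => h.
have h1 := sqr_ge0 p.1; have h2 := sqr_ge0 p.2.
by split; rewrite /= in_itv/=; apply/andP; split; nra.
Qed.

(** For the poles None and 0 these are the closed unit discs around 0 and around
   infinity. *)
Definition hemisphere o : set S2 := chart_inv o @` disc.

Lemma hemisphere_compact o : compact (hemisphere o).
Proof.
apply: continuous_compact; last exact: disc_compact.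
by apply: continuous_subspaceT; exact: chart_inv_continuous.
Qed.

Let sphere0 : S2 := Some (0 +i* 0)%C.

Lemma chart_inv0E p : p != 0 -> chart_inv sphere0 p =
  Some (p.1 / (p.1 ^+ 2 + p.2 ^+ 2) +i* (p.2 / (p.1 ^+ 2 + p.2 ^+ 2)))%C.
Proof. by move=> p0; rewrite /= (negbTE p0) !add0r. Qed.

Lemma hemispheresU : hemisphere None `|` hemisphere sphere0 = setT.
Proof.
apply/seteqP; split => // -[[a b]|] _; last first.
  right; exists 0; last by rewrite /= eqxx.
  by rewrite /disc/= expr0n/= addr0 ler01.
have [h|h] := leP (a ^+ 2 + b ^+ 2) 1; first by left; exists (a, b).
have n0 : 0 < a ^+ 2 + b ^+ 2 by exact: lt_trans h.
pose p : R * R := (a / (a ^+ 2 + b ^+ 2), b / (a ^+ 2 + b ^+ 2)).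
have E : p.1 ^+ 2 + p.2 ^+ 2 = (a ^+ 2 + b ^+ 2)^-1.
  by rewrite /=; field; rewrite gt_eqF.
right; exists p; first by rewrite /disc /mkset E invf_le1// ltW.
rewrite chart_inv0E ?E ?invrK /= ?divfK ?gt_eqF//.
apply/eqP => p0; move/eqP: E; rewrite p0 /= expr0n /= addr0 eq_sym invr_eq0.
by rewrite gt_eqF.
Qed.

Lemma hemispheresI : hemisphere None `&` hemisphere sphere0 =
  chart_inv None @` [set p | p.1 ^+ 2 + p.2 ^+ 2 = 1].
Proof.
apply/seteqP; split => z.
  move=> [[p pD <-] [q qD]]; have [->|q0] := eqVneq q 0; first by rewrite /= eqxx.
  rewrite chart_inv0E// => -[h1 h2]; exists p => //=.
  have n0 : 0 < q.1 ^+ 2 + q.2 ^+ 2.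
    rewrite lt_def addr_ge0 ?sqr_ge0// andbT; apply: contra q0.
    rewrite paddr_eq0 ?sqr_ge0// !sqrf_eq0 => /andP[/eqP q1 /eqP q2].
    by rewrite [q]surjective_pairing q1 q2.
  have E : p.1 ^+ 2 + p.2 ^+ 2 = (q.1 ^+ 2 + q.2 ^+ 2)^-1.
    by rewrite -h1 -h2; field; rewrite gt_eqF.
  apply/le_anti; rewrite pD E invf_ge1//=; exact: qD.
move=> [p /= pD <-]; split; first by exists p => //; rewrite /disc/= pD.
exists p; first by rewrite /disc/= pD.
rewrite chart_inv0E ?pD ?divr1//; apply/eqP => p0.
by move: pD; rewrite p0 /= expr0n addr0 => /eqP; rewrite eq_sym oner_eq0.
Qed.

Lemma circle_connected : connected [set p : R * R | p.1 ^+ 2 + p.2 ^+ 2 = 1].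
Proof.
pose arc (s : R) (t : R) : R * R := (t, s * Num.sqrt (1 - t ^+ 2)).
have carc s : continuous (arc s).
  move=> t; have h : (fun t : R => s * Num.sqrt (1 - t ^+ 2)) @ t --> s * Num.sqrt (1 - t ^+ 2).
    apply: cvgM; first exact: cvg_cst.
    apply: (@continuous_comp _ _ _ (fun t : R => 1 - t ^+ 2) Num.sqrt); last exact: sqrt_continuous.
    by apply: cvgB; [exact: cvg_cst|exact: exprn_continuous].
  exact: (cvg_pair (@cvg_id _ (nbhs t)) h).
have -> : [set p : R * R | p.1 ^+ 2 + p.2 ^+ 2 = 1] =
    (arc 1 @` `[-1, 1]) `|` (arc (-1) @` `[-1, 1]).
  apply/seteqP; split => [[a b] /= ab|p].
    have aI : a \in `[-1, 1].
      rewrite in_itv/=; have := sqr_ge0 b; have := sqr_ge0 a => *; apply/andP; split; nra.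
    have E : 1 - a ^+ 2 = b ^+ 2 by rewrite -ab addrC addKr.
    have [b0|b0] := leP 0 b; [left|right]; exists a => //; rewrite /arc E sqrtr_sqr.
      by rewrite ger0_norm// mul1r.
    by rewrite ltr0_norm// mulN1r opprK.
  have sq (s t : R) : s ^+ 2 = 1 -> t \in `[-1, 1] -> t ^+ 2 + (s * Num.sqrt (1 - t ^+ 2)) ^+ 2 = 1.
    rewrite in_itv/= => s1 /andP[t1 t2]; rewrite exprMn s1 mul1r sqr_sqrtr; last by nra.
    by rewrite addrC subrK.
  by move=> [] [t tI <-] /=; apply: sq => //; rewrite ?sqrrN expr1n.
apply: connectedU; last 2 first.
- exact: segment_connected_image.
- exact: segment_connected_image.
have I1 : (`[-1, 1]%classic : set R) 1 by rewrite /= in_itv/=; apply/andP; split; lra.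
by exists (1, 0); split; exists 1 => //; rewrite /arc expr1n subrr sqrtr0 mulr0.
Qed.

Lemma sphere_compact : compact [set: S2].
Proof. by rewrite -hemispheresU; apply: compactU; exact: hemisphere_compact. Qed.

(** The disc is star-shaped: the potential at x sums the cocycle along N equal steps
   of the segment from the centre to x. The segments to two nearby points bound a
   ladder of small cells. *)
Lemma hemisphere_cocycle_trivial o : cocycle_trivial (hemisphere o).
Proof.
move=> d c d0 cc; pose f := chart_inv o.
have [e e0 fe] : exists2 e, 0 < e & forall p q, disc p -> disc q ->
    mdist p q < e -> mdist (f p) (f q) < d.
  apply: compact_unif_continuous d0; first exact: disc_compact.
  by move=> p _; exact: chart_inv_continuous.
have [e' e'0 ge] : exists2 e', 0 < e' & forall x y, hemisphere o x -> hemisphere o y ->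
    mdist x y < e' -> mdist (chart o x) (chart o y) < e / 2.
  apply: compact_unif_continuous; first exact: hemisphere_compact.
    by move=> x [p _ <-]; apply: chart_continuous; exact: chart_inv_neq.
  by rewrite divr_gt0.
have [N Ne] : exists N : nat, (0 < N)%N /\ N%:R^-1 < e / 2.
  exists (Num.truncn (e / 2)^-1).+1; split => //.
  rewrite invf_plt ?posrE// ?divr_gt0//.
  by rewrite truncnS_gt.
have [N0 {}Ne] := Ne; have NR0 : (0 : R) < N%:R by rewrite ltr0n.
pose r (k : nat) : R := k%:R / N%:R.
have r01 k : (k <= N)%N -> 0 <= r k <= 1.
  move=> kN; rewrite divr_ge0 ?ler0n//= ler_pdivrMr// mul1r ler_nat//.
have disc1 p : disc p -> `|p.1| <= 1 /\ `|p.2| <= 1.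
  rewrite /disc/= => h; have h1 := sqr_ge0 p.1; have h2 := sqr_ge0 p.2.
  by rewrite !ler_norml; split; apply/andP; split; nra.
have disc_scale k p : (k <= N)%N -> disc p -> disc (scale (r k) p).
  move=> /r01/andP[r0 r1]; rewrite /disc/= => h; rewrite (exprMn 2 (r k) p.1) (exprMn 2 (r k) p.2) -mulrDr.
  have h1 := sqr_ge0 p.1; have h2 := sqr_ge0 p.2.
  have r2 : r k ^+ 2 <= 1 by nra.
  by rewrite (le_trans _ h)// ler_piMl// addr_ge0.
have scale_step k p : disc p -> mdist (scale (r k) p) (scale (r k.+1) p) <= N%:R^-1.
  move=> /disc1[p1 p2]; rewrite mdist_plane /= -(mulrBl p.1) -(mulrBl p.2) !normrM.
  have -> : `|r k - r k.+1| = N%:R^-1.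
    rewrite /r -mulrBl -natr1 opprD addrA subrr sub0r mulN1r normrN gtr0_norm//.
    by rewrite invr_gt0.
  by rewrite ge_max; apply/andP; split; rewrite ler_piMr ?invr_ge0// ltW.
have scale_dist k p q : (k <= N)%N -> mdist (scale (r k) p) (scale (r k) q) <= mdist p q.
  move=> /r01/andP[r0 r1]; rewrite !mdist_plane /= -(mulrBr (r k) p.1) -(mulrBr (r k) p.2).
  rewrite (normrM (r k) (p.1 - _)) (normrM (r k) (p.2 - _)) (ger0_norm r0).
  rewrite ge_max; apply/andP; split.
    by rewrite le_max ler_piMl.
  by rewrite le_max ler_piMl ?orbT.
pose K p := \big[addb/false]_(k < N) c (f (scale (r k) p)) (f (scale (r k.+1) p)).
exists (fun x => K (chart o x)), e' => // x y Hx Hy xy.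
have {}xy := ge x y Hx Hy xy.
have [p [pD xE]] : exists p, disc p /\ x = f p by case: Hx => p pD <-; exists p.
have [q [qD yE]] : exists q, disc q /\ y = f q by case: Hy => q qD <-; exists q.
rewrite xE yE /f !chartK in xy *.
pose pt (i : nat) := if i is 0 then p else q.
have ptD i : disc (pt i) by case: i.
have pt01 k : (k <= N)%N -> mdist (scale (r k) p) (scale (r k) q) < e / 2.
  by move=> kN; rewrite (le_lt_trans (scale_dist _ _ _ kN)).
pose H s t := c (f (scale (r s) (pt t))) (f (scale (r s.+1) (pt t))).
pose V s t := c (f (scale (r s) (pt t))) (f (scale (r s) (pt t.+1))).
have cell s t : (s < N)%N -> (t < 1)%N -> H s t (+) V s.+1 t = V s t (+) H s t.+1.
  move=> sN; rewrite ltnS leqn0 => /eqP->; rewrite /H /V /=.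
  have sN' := ltnW sN.
  have diag : mdist (scale (r s) p) (scale (r s.+1) q) < e.
    have := metric_triangle (scale (r s) p) (scale (r s) q) (scale (r s.+1) q).
    have := pt01 s sN'; have := scale_step s q qD; lra.
  have small u v : disc u -> disc v -> mdist u v <= N%:R^-1 \/ mdist u v < e / 2 ->
      mdist (f u) (f v) < d.
    by move=> uD vD h; apply: fe => //; case: h; lra.
  have [p0D p1D] := (disc_scale s p sN' pD, disc_scale s.+1 p sN pD).
  have [q0D q1D] := (disc_scale s q sN' qD, disc_scale s.+1 q sN qD).
  have pp := small _ _ p0D p1D (or_introl (scale_step s p pD)).
  have qq := small _ _ q0D q1D (or_introl (scale_step s q qD)).
  have pq0 := small _ _ p0D q0D (or_intror (pt01 s sN')).
  have pq1 := small _ _ p1D q1D (or_intror (pt01 s.+1 sN)).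
  have pq := fe _ _ p0D q1D diag.
  by rewrite (cc _ _ _ pp pq1 pq) (cc _ _ _ pq0 qq pq).
have := grid_boundary cell; rewrite !big_ord_recl !big_ord0 !addbF /V /= => E.
have r0 u : scale (r 0%N) u = 0 by rewrite /r mul0r /scale !mul0r.
have rN u : scale (r N) u = u.
  by rewrite /r divff ?gt_eqF// /scale !mul1r -surjective_pairing.
move: E; rewrite !r0 !rN (cocyclexx _ d0 cc) addFb -/(K p) -/(K q) => <-.
by rewrite addbA addbb.
Qed.

Lemma sphere_cocycle_trivial : cocycle_trivial [set: S2].
Proof.
rewrite -hemispheresU; apply: cocycle_trivialU; rewrite ?hemispheresI.
- exact: hemisphere_compact.
- exact: hemisphere_compact.
- by apply: connected_image_chart_inv; exact: circle_connected.
- by exists (chart_inv None (1, 0)), (1, 0) => //=; rewrite expr1n expr0n addr0.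
- exact: hemisphere_cocycle_trivial.
- exact: hemisphere_cocycle_trivial.
Qed.

Lemma sphere_unicoherent (X Y : set S2) : closed X -> closed Y ->
  connected X -> connected Y -> X `|` Y = setT -> connected (X `&` Y).
Proof.
apply: cocycle_trivial_unicoherent; first exact: sphere_compact.
exact: sphere_cocycle_trivial.
Qed.

End sphere_topology.

(** * Domains of the sphere *)

Section sphere_domains.
Context {R : realType}.
Local Notation S2 := (riemann_sphere R).
Implicit Types (A B K O P T U V W Z : set S2) (a b p q x y z w : S2) (c d e r : R).

Lemma sphere_closed_compact A : closed A -> compact A.
Proof. by move=> cA; exact: subclosed_compact cA sphere_compact _. Qed.

Lemma sphere_nbhs_connected x d : 0 < d -> exists V, [/\ open V, V x, connected V &
  forall y, V y -> mdist x y < d].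
Proof.
move=> d0; have [|||V [oV Vx VU cV]] := @sphere_locally_connected R x _ [set y | mdist x y < d].
- by [].
- exact: open_mdist_lt.
- by rewrite /= mdistxx.
rewrite setTI in VU cV; by exists V; split => // y /VU.
Qed.

Lemma component_open O W : open O -> components O W -> open W.
Proof.
move=> oO OW; rewrite openE => x Wx; have Ox := components_sub OW Wx.
have [d d0 dO] := open_mdist oO Ox.
have [V [oV Vx cV Vd]] := sphere_nbhs_connected x d0.
apply: (filterS (P := V)); last exact: open_nbhs_nbhs.
apply: (components_max OW cV); first by move=> y /Vd /dO.
by exists x.
Qed.

Lemma component_boundary O W : open O -> components O W -> boundary W `<=` ~` O.
Proof.
move=> oO OW x; rewrite boundary_open; last exact: component_open OW.
move=> [cW nW] Ox; apply: nW.
have OC := components_component Ox.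
have oC := component_open oO OC.
have [|y [Wy Cy]] := cW (connected_component O x).
  by apply: open_nbhs_nbhs; split => //; exact: connected_component_refl.
rewrite (components_inj OW OC); first exact: connected_component_refl.
by exists y.
Qed.

Lemma boundary_nonempty O : O !=set0 -> ~` O !=set0 -> boundary O !=set0.
Proof.
move=> [x Ox] [y nOy]; have [||z [_ bz]] := @connected_meets_boundary _ setT O sphere_connected.
- by exists x.
- by exists y.
by exists z.
Qed.

(** The boundary of W is the intersection of its closure with its complement, and both
   are connected. *)
Lemma domain_boundary_connected Z W : closed Z -> connected Z -> Z !=set0 ->
  components (~` Z) W -> connected (boundary W).
Proof.
move=> clZ cZ Z0 ZW.
have oW : open W by apply: component_open ZW; exact: closed_openC.
rewrite boundary_open//; apply: sphere_unicoherent.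
- exact: closed_closure.
- exact: open_closedC.
- exact/connected_closure/(components_connected ZW).
- exact: connected_compl_component sphere_connected cZ Z0 ZW.
- apply/seteqP; split => // x _; have [Wx|] := pselect (W x); last by right.
  by left; exact: subset_closure.
Qed.

Lemma compact_connected_pair W a b : open W -> connected W -> W a -> W b ->
  exists T, [/\ compact T, connected T, T a, T b & T `<=` W].
Proof.
move=> oW cW Wa Wb.
apply: (@connected_spread _ W (fun b => exists T,
  [/\ compact T, connected T, T a, T b & T `<=` W]) a cW) => //.
  exists [set a]; split => //; [exact: compact_set1|exact: connected1|by move=> _ ->].
move=> z Wz; have [d d0 dW] := open_mdist oW Wz.
have d20 : 0 < d / 2 by rewrite divr_gt0.
have [V [oV Vz cV Vd]] := sphere_nbhs_connected z d20.
exists V; first exact: open_nbhs_nbhs.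
have clVW : closure V `<=` W.
  move=> y /closure_mdist/(_ _ d20)[v /Vd zv yv]; apply: dW.
  have := metric_triangle z v y; rewrite (metric_sym v y); lra.
have step u v : V u -> V v -> (exists T, [/\ compact T, connected T, T a, T u & T `<=` W]) ->
    exists T, [/\ compact T, connected T, T a, T v & T `<=` W].
  move=> Vu Vv [T [kT cT Ta Tu TW]]; exists (T `|` closure V); split.
  - by apply: compactU => //; exact/sphere_closed_compact/closed_closure.
  - apply: connectedU => //; last exact: connected_closure.
    by exists u; split => //; exact: subset_closure.
  - by left.
  - by right; exact: subset_closure.
  - by move=> y [/TW|/clVW].
by move=> w Ww Vw; split; exact: step.
Qed.

(** If finitely many colours i serve all members of a directed family, one colour
   serves all of them. *)
Lemma finite_pigeonhole {I : eqType} (s : seq I) (D : set (set S2)) (Q : I -> set S2 -> Prop) :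
  D !=set0 -> (forall A B, D A -> D B -> D (A `|` B)) ->
  (forall i A B, A `<=` B -> Q i B -> Q i A) ->
  (forall A, D A -> exists2 i, i \in s & Q i A) ->
  exists2 i, i \in s & forall A, D A -> Q i A.
Proof.
move=> [D0 DD0] DU Qanti; elim: s => [|i s IH] h; first by have [] := h D0 DD0.
have [hi|/existsNP[A0 /not_implyP[DA0 nQ]]] := pselect (forall A, D A -> Q i A).
  by exists i => //; exact: mem_head.
have [|j js hj] := IH; last by exists j => //; rewrite inE js orbT.
move=> A DA; have [j] := h _ (DU A A0 DA DA0); rewrite inE => /orP[/eqP->|js] Qj.
  by exfalso; apply: nQ; apply: Qanti Qj => x; right.
by exists j => //; apply: Qanti Qj => x; left.
Qed.

Lemma directed_cover F (D : set (set S2)) (O : set S2 -> set S2) : compact F ->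
  D !=set0 -> (forall A B, D A -> D B -> D (A `|` B)) ->
  (forall A B, A `<=` B -> open (O A) /\ O A `<=` O B) ->
  (forall x, F x -> exists2 T, D T & O T x) -> exists2 T, D T & F `<=` O T.
Proof.
move=> kF [T0 DT0] DU hO cov; have clF := compact_closed_metric kF.
have oO A : open (O A) by have [] := hO A A (@subset_refl _ A).
pose G := [set A | [/\ closed A, A `<=` F & exists2 T, D T & F `\` O T `<=` A]].
have GD T : D T -> G (F `\` O T).
  move=> DT; split; [|by move=> x []|by exists T].
  by apply: closedI => //; exact: open_closedC.
have [|||||A [_ _ [T DT FA]] A0] := @compact_directed _ _ F G set0 kF.
- by exists (F `\` O T0); exact: GD.
- by move=> A [].
- move=> A B [clA AF [TA DA hA]] [clB BF [TB DB hB]]; split; first exact: closedI.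
    by move=> x [/AF].
  exists (TA `|` TB); first exact: DU.
  move=> x [Fx nT]; split; [apply: hA|apply: hB]; split => // Tx; apply: nT.
    by have [_] := hO TA (TA `|` TB) (@subsetUl _ _ _); apply.
  by have [_] := hO TB (TA `|` TB) (@subsetUr _ _ _); apply.
- exact: open0.
- move=> x Gx; have [Fx _] := Gx _ (GD _ DT0).
  have [T DT Tx] := cov x Fx; by have [_] := Gx _ (GD _ DT).
exists T => // x Fx; apply: contrapT => nTx.
by apply: (A0 x); apply: FA.
Qed.

Lemma compact_connected_hull W F : open W -> connected W -> W !=set0 ->
  compact F -> F `<=` W -> exists T, [/\ compact T, connected T, F `<=` T & T `<=` W].
Proof.
move=> oW cW [a Wa] kF FW.
pose good T := [/\ compact T, connected T, T a & T `<=` W].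
have goodU A B : good A -> good B -> good (A `|` B).
  move=> [kA cA Aa AW] [kB cB Ba BW]; split.
  - exact: compactU.
  - by apply: connectedU => //; exists a.
  - by left.
  - by move=> x [/AW|/BW].
have good_nbhs x : W x -> exists2 T, good T & interior T x.
  move=> Wx; have [d d0 dW] := open_mdist oW Wx.
  have d20 : 0 < d / 2 by rewrite divr_gt0.
  have [V [oV Vx cV Vd]] := sphere_nbhs_connected x d20.
  have clVW : closure V `<=` W.
    move=> y /closure_mdist/(_ _ d20)[v /Vd zv yv]; apply: dW.
    have := metric_triangle x v y; rewrite (metric_sym v y); lra.
  have [T [kT cT Ta Tx TW]] := compact_connected_pair oW cW Wa Wx.
  exists (T `|` closure V); first split.
  - by apply: compactU => //; exact/sphere_closed_compact/closed_closure.
  - apply: connectedU => //; last exact: connected_closure.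
    by exists x; split => //; exact: subset_closure.
  - by left.
  - by move=> y [/TW|/clVW].
  - apply: (filterS (P := V)); last exact: open_nbhs_nbhs.
    by move=> y Vy; right; exact: subset_closure.
have [||||T [kT cT Ta TW] FT] := @directed_cover F good (@interior _) kF.
- by have [T gT _] := good_nbhs a Wa; exists T.
- exact: goodU.
- by move=> A B AB; split; [exact: open_interior|exact: interiorS].
- by move=> x /FW /good_nbhs[T gT Tx]; exists T.
by exists T; split => // x /FT /interior_subset.
Qed.

(** The complement of a point s is connected, so the points at distance at least r / 2
   from s lie in a connected set T that misses a neighbourhood of s. When the
   boundary of O is close to s, it misses T, so T lies in O or in its complement. *)
Lemma small_boundary r : 0 < r -> exists2 c, 0 < c & forall O, O !=set0 -> ~` O !=set0 ->
  ~ (c%:E < diam (boundary O))%E ->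
  (forall x y, O x -> O y -> mdist x y < r) \/
  (forall x y, ~ O x -> ~ O y -> mdist x y < r).
Proof.
move=> r0; have r40 : 0 < r / 4 by rewrite divr_gt0.
pose Q s c := exists T, [/\ connected T, (forall x, r / 2 <= mdist s x -> T x) &
  forall t, T t -> c <= mdist s t].
have [||c c0 h] := @compact_uniform R S2 setT Q sphere_compact.
- move=> s c c' cc [T [cT FT Tc]]; exists T; split => // t /Tc; exact: le_trans.
- move=> s _; pose W := ~` [set s].
  have oW : open W.
    by apply: closed_openC; apply: compact_closed_metric; exact: compact_set1.
  pose F := [set x | r / 4 <= mdist s x].
  have kF : compact F by apply: sphere_closed_compact; exact: closed_mdist_ge.
  have FW : F `<=` W by move=> x + xs; rewrite /F /= xs mdistxx leNgt r40.
  have W0 : W !=set0 by have [x xs] := exists_neq_sphere s; exists x.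
  have [T [kT cT FT TW]] := compact_connected_hull oW (@sphere_minus_point_connected R s) W0 kF FW.
  have nTs : ~ T s by move=> /TW; apply.
  have [e e0 eT] := closed_mdist (compact_closed_metric kT) nTs.
  pose d := Num.min (r / 4) (e / 2).
  have d0 : 0 < d by rewrite lt_min r40 divr_gt0.
  have [dr de] : d <= r / 4 /\ d <= e / 2 by rewrite /d !ge_min !lexx orbT.
  exists d => // y _ sy; exists T; split => // [x yx|t Tt].
    by apply: FT; rewrite /F /=; have := metric_triangle y s x; rewrite (metric_sym y s); lra.
  by have := eT t Tt; have := metric_triangle s y t; lra.
exists (c / 2) => [|O O0 nO0 nd]; first by rewrite divr_gt0.
have [s bs] := boundary_nonempty O0 nO0.
have [T [cT FT Tc]] := h s I.
have [|/existsNP[x /not_implyP[Ox /negP]]] :=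
    pselect (forall x, O x -> mdist s x < r / 2).
  move=> hO; left=> x y /hO sx /hO sy; have := metric_triangle x s y.
  rewrite (metric_sym x s); lra.
rewrite -leNgt => sx.
have hO y : ~ O y -> mdist s y < r / 2.
  move=> nOy; rewrite ltNge; apply/negP => sy.
  have [||t [Tt bt]] := @connected_meets_boundary _ T O cT.
  - by exists x; split => //; exact: FT.
  - by exists y; split => //; exact: FT.
  by have := Tc t Tt; have := diam_le_mdist nd bs bt; lra.
right=> u v /hO su /hO sv; have := metric_triangle u s v; rewrite (metric_sym u s); lra.
Qed.

(** A clopen part D of K around P is separated from the rest of K and from T by a
   positive distance; G is the component of a neighbourhood of D. *)
Lemma isolating_domain K P T : compact K -> components K P -> closed T ->
  T `&` P = set0 -> exists G, [/\ open G, connected G, P `<=` G,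
    closure G `&` T = set0 & boundary G `&` K = set0].
Proof.
move=> kK KP clT TP; have [p Pp] := components_nonempty KP.
have Kp := components_sub KP Pp.
have PE := components_eq KP Pp.
have [||D [E [cD cE KE DE0 [CD DN]]]] := @compact_component_clopen _ _ K p (~` T) kK Kp.
- exact: closed_openC.
- by rewrite -PE => x Px Tx; have : (T `&` P) x by []; rewrite TP.
have kD : compact D by exact: sphere_closed_compact.
have [|d d0 dP] := @disjoint_mdist _ _ D (E `|` T) kD (closedU cE clT).
  rewrite -subset0 => x [Dx [Ex|Tx]]; last exact: (DN x Dx).
  by have : (D `&` E) x by []; rewrite DE0.
pose G' := \bigcup_(x in D) [set y | mdist x y < d / 2].
have oG' : open G' by apply: bigcup_open => x _; exact: open_mdist_lt.
have d20 : 0 < d / 2 by rewrite divr_gt0.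
have DG' : D `<=` G' by move=> x Dx; exists x => //=; rewrite mdistxx.
have PD : P `<=` D by rewrite PE.
pose G := connected_component G' p.
have GC : components G' G by apply: components_component; apply: DG'; exact: PD.
have far w : closure G w -> ~ (E `|` T) w.
  have d40 : 0 < d / 4 by rewrite divr_gt0.
  move=> /closure_mdist/(_ _ d40)[g /(components_sub GC)[x Dx /= xg] wg] ETw.
  have := dP x w Dx ETw; have := metric_triangle x g w; rewrite (metric_sym g w); lra.
exists G; split.
- exact: component_open GC.
- exact: components_connected GC.
- apply: (components_max GC (components_connected KP)).
    by move=> x /PD /DG'.
  by exists p; split => //; apply: connected_component_refl; apply: DG'; exact: PD.
- by rewrite -subset0 => w [/far nw Tw]; apply: nw; right.
- rewrite -subset0 => w [bw]; rewrite KE => -[Dw|Ew].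
    by apply: (component_boundary oG' GC bw); exact: DG'.
  by apply: (far w) => //; [exact: bw.1|left].
Qed.

(** The second condition in the definition of an E-compactum. *)
Definition null_complement K := forall e, 0 < e ->
  finite_set [set U | components (~` K) U /\ (e%:E < diam U)%E].

(** For every continuum T in W through a and a second point b of W, a domain isolating
   P from T has a complementary domain V that contains T. The boundary of V is
   connected, misses K, and cannot be small because V contains a and b while its
   complement contains p and q. Hence it lies in one of the finitely many large
   components of the complement of K, and by the pigeonhole principle one such U
   serves all T. Points of W close to P can be included in T, so the boundary of V,
   which lies in U, comes close to every point of the boundary of W. Any other
   component containing a is trapped in V, away from P. *)
Lemma adjacent_component K P p q a : compact K -> null_complement K ->
  components K P -> P p -> P q -> p <> q -> ~ P a ->
  let W := connected_component (~` P) a in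
  exists U, [/\ components (~` K) U, U `<=` W, boundary W `<=` boundary U &
    forall U', components (~` K) U' -> U' a -> U' <> U -> closure U' `&` P = set0].
Proof.
move=> kK EK KP Pp Pq pq nPa W.
have clK := compact_closed_metric kK; have clP := components_closed clK KP.
have PK := components_sub KP; have cP := components_connected KP.
have oP : open (~` P) by exact: closed_openC.
have oK : open (~` K) by exact: closed_openC.
have WC : components (~` P) W by exact: components_component.
have oW := component_open oP WC; have cW := components_connected WC.
have Wa : W a by exact: connected_component_refl.
have WP x : W x -> P x -> False by move=> /(components_sub WC).
have [b Wb ab] : exists2 b, W b & a <> b.
  apply: contrapT => nb; have WE : W = [set a].
    apply/seteqP; split => [x Wx|_ -> //]; apply: contrapT => xa; apply: nb.
    by exists x => // ax; apply: xa.
  have [||z [_]] := @connected_meets_boundary _ setT W sphere_connected.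
  - by exists a.
  - by exists p; split => // /WP; apply.
  rewrite boundary_open// WE => -[cz nz]; apply: nz.
  by rewrite -(closure_id [set a]).1// in cz; apply: compact_closed_metric; exact: compact_set1.
pose r := Num.min (mdist a b) (mdist p q).
have r0 : 0 < r by rewrite lt_min !mdist_gt0; apply/andP; split; apply/eqP.
have [c c0 small] := small_boundary r0.
have /finite_seqP[s sE] := EK c c0.
pose D := [set T | [/\ compact T, connected T, T a, T b & T `<=` W]].
pose Q U T := exists V, [/\ open V, connected V, T `<=` V /\ closure V `<=` W,
  closure V `&` P = set0 & boundary V `<=` U].
have [||||U Us QU] := @finite_pigeonhole _ s D Q.
- exact: compact_connected_pair.
- move=> A B [kA cA Aa Ab AW] [kB cB Ba Bb BW]; split.
  + exact: compactU.
  + by apply: connectedU => //; exists a.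
  + by left.
  + by left.
  + by move=> x [/AW|/BW].
- move=> U A B AB [V [oV cV [BV VW] VP bV]]; exists V; split => //.
  by split => // x /AB /BV.
- move=> T [kT cT Ta Tb TW].
  have TP0 : T `&` P = set0 by rewrite -subset0 => x [/TW /WP].
  have [G [oG cG PG GT bG]] := isolating_domain kK KP (compact_closed_metric kT) TP0.
  have nGa : ~ closure G a by move=> Ga; have : (closure G `&` T) a by []; rewrite GT.
  pose V := connected_component (~` closure G) a.
  have clG : closed (closure G) by exact: closed_closure.
  have VC : components (~` closure G) V by exact: components_component.
  have oV : open V by apply: component_open VC; exact: closed_openC.
  have TV : T `<=` V.
    apply: (connected_component_max Ta _ cT) => x Tx Gx.
    by have : (closure G `&` T) x by []; rewrite GT.
  have VG x : closure V x -> ~ G x.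
    move=> cVx Gx; have [|y [/(components_sub VC) nGy Gy]] := cVx G.
      exact: open_nbhs_nbhs.
    by apply: nGy; exact: subset_closure.
  have VP : closure V `&` P = set0 by rewrite -subset0 => x [/VG nG /PG].
  have bVG : boundary V `<=` boundary G.
    move=> x bx; rewrite boundary_open//; split; last exact: VG bx.1.
    by apply: contrapT; apply: (component_boundary (closed_openC clG) VC bx).
  have cbV : connected (boundary V).
    apply: (domain_boundary_connected clG _ _ VC); first exact: connected_closure.
    by exists p; apply: subset_closure; exact: PG.
  have nV x : P x -> ~ V x.
    by move=> Px Vx; apply: (VG x); [exact: subset_closure|exact: PG].
  have dV : (c%:E < diam (boundary V))%E.
    apply: contrapT => nd; have [||h|h] := small V _ _ nd.
    - by exists a; exact: TV.
    - by exists p; exact: nV.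
    - by have := h a b (TV a Ta) (TV b Tb); rewrite lt_min ltxx.
    - by have := h p q (nV p Pp) (nV q Pq); rewrite lt_min ltxx andbF.
  have /diam_gtP[u [v [bu bv uv]]] := dV.
  have [U UC bVU] : exists2 U, components (~` K) U & boundary V `<=` U.
    apply: components_ex => //; first by exists u.
    by move=> x /bVG bx Kx; have : (boundary G `&` K) x by []; rewrite bG.
  exists U.
    suff : [set` s] U by [].
    by rewrite -sE; split => //; exact: diam_gt_subset dV.
  exists V; split => //; first exact: components_connected VC.
  split => //; apply: (components_max WC).
  + exact/connected_closure/(components_connected VC).
  + by move=> x cx Px; have : (closure V `&` P) x by []; rewrite VP.
  + by exists a; split => //; apply: subset_closure; exact: TV.
have [UC dU] : components (~` K) U /\ (c%:E < diam U)%E.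
  by have : [set` s] U by []; rewrite -sE.
have oU := component_open oK UC.
have [T0 DT0] := compact_connected_pair oW cW Wa Wb.
have UW : U `<=` W.
  have [V [oV cV [TV VW] VP bV]] := QU T0 DT0.
  have [_ _ T0a _ _] := DT0.
  have [||u bu] := @boundary_nonempty V.
  - by exists a; exact: TV.
  - exists p => Vp; have : (closure V `&` P) p by split => //; exact: subset_closure.
    by rewrite VP.
  apply: (components_max WC (components_connected UC)).
    by move=> x /(components_sub UC) nK /PK.
  by exists u; split; [exact: bV|exact: VW bu.1].
exists U; split => //.
- move=> w bw; have Pw : P w by apply: contrapT; exact: (component_boundary oP WC bw).
  rewrite boundary_open//; split; last by move=> /(components_sub UC); apply; exact: PK.
  apply/closure_mdist => d d0.
  have [B [oB Bw cB Bd]] := sphere_nbhs_connected w d0.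
  have [|y [Wy By]] := bw.1 B; first by apply: open_nbhs_nbhs; split.
  have [T1 [kT1 cT1 T1a T1y T1W]] := compact_connected_pair oW cW Wa Wy.
  have [kT0 cT0 T0a T0b T0W] := DT0.
  have [|V [oV cV [TV VW] VP bV]] := QU (T0 `|` T1).
    split; [exact: compactU| |by left|by left|by move=> x [/T0W|/T1W]].
    by apply: connectedU => //; exists a.
  have [||z [Bz bz]] := @connected_meets_boundary _ B V cB.
  + by exists y; split => //; apply: TV; right.
  + exists w; split => // Vw; have : (closure V `&` P) w by split => //; exact: subset_closure.
    by rewrite VP.
  by exists z; [exact: bV|exact: Bd].
- move=> U' U'C U'a U'U.
  have [V [oV cV [TV VW] VP bV]] := QU T0 DT0.
  have [_ _ T0a _ _] := DT0.
  suff U'V : U' `<=` V.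
    by rewrite -subset0 -VP; apply: setSI; exact: closureS.
  apply: contrapT => /existsNP[x /not_implyP[U'x nVx]].
  have [||z [U'z bz]] := @connected_meets_boundary _ U' V (components_connected U'C).
  + by exists a; split => //; exact: TV.
  + by exists x.
  by apply: U'U; apply: (components_inj U'C UC); exists z; split => //; exact: bV.
Qed.

End sphere_domains.

(** * From the boundaries to the compactum *)

Section peano_from_boundaries.
Context {R : realType}.
Local Notation S2 := (riemann_sphere R).
Implicit Types (A B J K O P S T U V W Z : set S2) (a p q x y z w : S2) (c d e r : R).

(** Each part of S in a component W of the complement of P is replaced by a connected
   subset J W of P that contains all points where S meets the boundary of W. A
   separation of the resulting set would induce a separation of S: assign W to the
   side of J W. The sides are separated in S, because only finitely many W are
   large, and a small W that comes near a point has its exit points near it. *)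
Lemma joined_connected P S (J : set S2 -> set S2) : closed P -> connected S ->
  S `&` P !=set0 ->
  (forall W, components (~` P) W -> W `&` S !=set0 ->
    [/\ connected (J W), S `&` boundary W `<=` J W & J W `<=` P]) ->
  (forall e, 0 < e -> finite_set [set W | components (~` P) W /\ (e%:E < diam W)%E]) ->
  connected ((S `&` P) `|`
    \bigcup_(W in [set W | components (~` P) W /\ W `&` S !=set0]) J W).
Proof.
move=> clP cS [x0 [Sx0 Px0]] hJ null; set Y := (X in connected X).
have oP : open (~` P) by exact: closed_openC.
have gate W : components (~` P) W -> W `&` S !=set0 -> exists2 u, S u & boundary W u.
  move=> WC [w [Ww Sw]]; have [||u [Su bu]] := @connected_meets_boundary _ S W cS.
  - by exists w.
  - by exists x0; split => // /(components_sub WC).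
  by exists u.
have JY W : components (~` P) W -> W `&` S !=set0 -> J W `<=` Y.
  by move=> WC WS y Jy; right; exists W.
have YP : Y `<=` P.
  by move=> y [[]//|[W [WC WS] Jy]]; have [_ _] := hJ W WC WS; exact.
apply/connectedP => E [E0 EU sE].
have EY b : E b `<=` Y by rewrite EU; case: b; [right|left].
have sepE b z : E b z -> closure (E (~~ b)) z -> False.
  case: b => Ez cz /=; have [s1 s2] := sE.
    by have := conj cz Ez : (closure (E false) `&` E true) z; rewrite s1.
  by have := conj Ez cz : (E false `&` closure (E true)) z; rewrite s2.
have disE b z : E b z -> E (~~ b) z -> False.
  by move=> Ez /subset_closure; exact: sepE Ez.
have side W : components (~` P) W -> W `&` S !=set0 -> exists b, J W `<=` E b.
  move=> WC WS; have [cJ _ _] := hJ W WC WS.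
  have [||h] := connected_subset sE _ cJ; first by rewrite -EU; exact: JY.
    by exists false.
  by exists true.
pose F b := [set z | S z /\ (E b z \/
  exists W, [/\ components (~` P) W, W z & J W `<=` E b])].
have FP b z : F b z -> P z -> E b z.
  by move=> [_ [//|[W [WC Wz _]]]] Pz; have := components_sub WC Wz.
have sepF b z : F b z -> closure (F (~~ b)) z -> False.
  move=> Fz cz; have [Sz _] := Fz; have [Pz|nPz] := pselect (P z); last first.
    have WC := @components_component _ (~` P) z nPz; set W := connected_component _ _ in WC.
    have Wz : W z by exact: connected_component_refl.
    have oW := component_open oP WC.
    have WS : W `&` S !=set0 by exists z.
    have FW b' v : F b' v -> W v -> J W `<=` E b'.
      move=> [_ [/EY/YP Pv /(components_sub WC)//|[W' [W'C W'v JW']]]] Wv.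
      by rewrite (components_inj WC W'C)//; exists v.
    have [|v [Fv Wv]] := cz W; first exact: open_nbhs_nbhs.
    have [u Su bu] := gate W WC WS; have [_ hb _] := hJ W WC WS.
    have Ju : J W u by apply: hb.
    exact: disE (FW b z Fz Wz u Ju) (FW (~~ b) v Fv Wv u Ju).
  have Ez := FP b z Fz Pz.
  have [|d d0 dE] := @closed_mdist R S2 (closure (E (~~ b))) z (@closed_closure _ _).
    by move=> cEz; exact: sepE Ez cEz.
  have d20 : 0 < d / 2 by rewrite divr_gt0.
  have /finite_seqP[s sP] := null _ d20.
  have [|W Ws|r r0 rP] := @finite_uniform R _ s (fun W r => J W `<=` E (~~ b) ->
      W `&` S !=set0 -> forall v, W v -> r <= mdist z v).
  - by move=> W r r' rr h JW WS v Wv; rewrite (le_trans rr)//; exact: h.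
  - have [WC _] : components (~` P) W /\ (((d / 2)%:E < diam W)%E).
      by have : [set` s] W by []; rewrite -sP.
    have [[JW WS]|nJ] := pselect (J W `<=` E (~~ b) /\ W `&` S !=set0); last first.
      by exists 1 => // JW WS; exfalso; apply: nJ.
    have [|r r0 rP] := @closed_mdist R S2 (closure W) z (@closed_closure _ _).
      move=> cWz; have [_ hb _] := hJ W WC WS.
      apply: (disE b z Ez); apply: JW; apply: hb; split => //.
      rewrite boundary_open; last exact: component_open WC.
      by split => // /(components_sub WC).
    by exists r => // _ _ v Wv; apply: rP; exact: subset_closure.
  have m0 : 0 < Num.min (d / 2) r by rewrite lt_min d20.
  have /closure_mdist/(_ _ m0)[v [Sv Fv]] := cz.
  rewrite lt_min => /andP[zvd zvr].
  case: Fv => [Ev|[W [WC Wv JW]]].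
    by have := dE v (subset_closure Ev); lra.
  have WS : W `&` S !=set0 by exists v.
  have [big|small] := pselect (((d / 2)%:E < diam W)%E).
    have Ws : W \in s by have : [set` s] W by rewrite -sP.
    by have := rP W Ws JW WS v Wv; lra.
  have [u Su bu] := gate W WC WS; have [_ hb _] := hJ W WC WS.
  have Eu : E (~~ b) u by apply: JW; apply: hb.
  have := dE u (subset_closure Eu).
  have nsm : ~ ((d / 2)%:E < diam (closure W))%E by move=> /diam_closure_gt.
  have := diam_le_mdist nsm (subset_closure Wv) bu.1.
  have := metric_triangle z v u; lra.
have SF : S `<=` F false `|` F true.
  move=> z Sz; have [Pz|nPz] := pselect (P z).
    have : Y z by left. by rewrite EU => -[Ez|Ez]; [left|right]; split => //; left.
  have WC := @components_component _ (~` P) z nPz; set W := connected_component _ _ in WC.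
  have Wz : W z by exact: connected_component_refl.
  have [|[] JW] := side W WC; first by exists z.
    by right; split => //; right; exists W.
  by left; split => //; right; exists W.
have sF : separated (F false) (F true).
  by split; rewrite -subset0 => z [h1 h2]; [exact: (sepF true z)|exact: (sepF false z)].
have all_side b : S `<=` F b -> False.
  move=> SFb; have [y Ey] := E0 (~~ b).
  have SPE z : S z -> P z -> E b z by move=> /SFb; exact: FP.
  case: (EY _ _ Ey) => [[Sy Py]|[W [WC WS] Jy]]; first by exact: disE (SPE y Sy Py) Ey.
  have [u Su bu] := gate W WC WS; have [cJ hb JP] := hJ W WC WS.
  have Ju : J W u by apply: hb.
  have [[] JW] := side W WC WS; case: b SPE Ey {SFb} => SPE Ey.
  - exact: disE (JW y Jy) Ey.
  - exact: (disE false u (SPE u Su (JP u Ju))) (JW u Ju).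
  - exact: (disE true u (SPE u Su (JP u Ju))) (JW u Ju).
  - exact: disE (JW y Jy) Ey.
by have [] := connected_subset sF SF cS => /all_side.
Qed.

Lemma boundary_diam_gt r : 0 < r -> exists2 c, 0 < c & forall O x y p q,
  O x -> O y -> ~ O p -> ~ O q -> r <= mdist x y -> r <= mdist p q ->
  (c%:E < diam (boundary O))%E.
Proof.
move=> r0; have [c c0 small] := small_boundary r0; exists c => // O x y p q Ox Oy nOp nOq xy pq.
apply: contrapT => nd; have [||h|h] := small O _ _ nd; [by exists x|by exists p| |].
  by have := h x y Ox Oy; rewrite ltNge xy.
by have := h p q nOp nOq; rewrite ltNge pq.
Qed.

(** The union of the components of K that meet Z. It recovers a component of K from
   any nonempty subset of it. *)
Let hull K Z := [set x | exists2 z, Z z & connected_component K z x].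

Let hullE K Z P : components K P -> Z `<=` P -> Z !=set0 -> hull K Z = P.
Proof.
move=> KP ZP [z Zz]; apply/seteqP; split => x.
  by move=> [w Zw]; rewrite -(components_eq KP (ZP w Zw)).
by move=> Px; exists z => //; rewrite -(components_eq KP (ZP z Zz)).
Qed.

Context (K : set S2) (kK : compact K) (EK : null_complement K).

Let clK : closed K. Proof. exact: compact_closed_metric. Qed.

(** Distinct domains W of the complement of P have distinct adjacent components U,
   which are large when W is. *)
Lemma finite_large_domains P p q e : components K P -> P p -> P q -> p <> q -> 0 < e ->
  finite_set [set W | components (~` P) W /\ (e%:E < diam W)%E].
Proof.
move=> KP Pp Pq pq e0.
have r0 : 0 < Num.min e (mdist p q) by rewrite lt_min e0 mdist_gt0; exact/eqP.
have [c c0 big] := boundary_diam_gt r0.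
apply: sub_finite_set (finite_image (hull (~` P)) (EK c0)) => W [WC dW].
have [a Wa] := components_nonempty WC.
have nPa : ~ P a := components_sub WC Wa.
have [U [UC UW bWU _]] := adjacent_component kK EK KP Pp Pq pq nPa.
rewrite -(components_eq WC Wa) in UW bWU.
exists U; last exact: hullE (components_nonempty UC).
split => //; apply: diam_closure_gt; apply: (diam_gt_subset (A := boundary W)).
  by move=> x /bWU[].
have /diam_gtP[x [y [Wx Wy xy]]] := dW.
apply: (big W x y p q) => //.
- by move=> /(components_sub WC).
- by move=> /(components_sub WC).
- by rewrite ge_min ltW.
- by rewrite ge_min lexx orbT.
Qed.

Lemma locally_connected_subsingleton P : (forall x y, P x -> P y -> x = y) ->
  locally_connected P.
Proof.
move=> P1; apply: im_kleinen_locally_connected => x e Px e0; exists 1 => // y Py _.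
exists [set x]; split => //; [exact: connected1|exact: P1|by move=> _ ->|].
by move=> _ ->; rewrite mdistxx.
Qed.

Context (pb : forall U, components (~` K) U -> peano_compactum (boundary U)).

Let boundary_sub U : components (~` K) U -> boundary U `<=` K.
Proof.
move=> UC x bx; apply: contrapT.
exact: (component_boundary (closed_openC clK) UC bx).
Qed.

Lemma adjacent_boundary_component P p q a : components K P -> P p -> P q -> p <> q ->
  ~ P a -> let W := connected_component (~` P) a in
  exists U Z, [/\ components (~` K) U, components (boundary U) Z,
    boundary W `<=` boundary U, boundary W `<=` Z & Z `<=` P].
Proof.
move=> KP Pp Pq pq nPa W.
have clP := components_closed clK KP.
have [U [UC UW bWU _]] := adjacent_component kK EK KP Pp Pq pq nPa.
have WC : components (~` P) W by exact: components_component.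
have cbW : connected (boundary W).
  by apply: (domain_boundary_connected clP (components_connected KP) _ WC); exists p.
have [w bw] : boundary W !=set0.
  apply: boundary_nonempty; first exact: components_nonempty WC.
  by exists p => /(components_sub WC).
have bWP : boundary W `<=` P.
  by move=> x bx; apply: contrapT; exact: (component_boundary (closed_openC clP) WC bx).
have [|Z ZC bWZ] := components_ex cbW _ bWU; first by exists w.
exists U, Z; split => //; apply: (components_max KP (components_connected ZC)).
  by move=> x /(components_sub ZC) /(boundary_sub UC).
by exists w; split; [exact: bWZ|exact: bWP].
Qed.

(** Fix a large component P0. For any other large component P the domain of the
   complement of P that contains P0 has a large connected boundary, which lies in a
   large component Z of the boundary of a large U; and Z determines P. *)
Lemma peano_nullity C : 0 < C ->
  finite_set [set P | components K P /\ (C%:E < diam P)%E].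
Proof.
move=> C0; set S := (X in finite_set X).
have [[P0 [P0C dP0]]|S0] := pselect (S !=set0); last first.
  rewrite (_ : S = set0); first exact: finite_set0.
  by rewrite -subset0 => P SP; apply: S0; exists P.
have /diam_gtP[a [b [Pa Pb ab]]] := dP0.
have [c c0 big] := boundary_diam_gt C0.
pose F := [set U | components (~` K) U /\ (c%:E < diam U)%E].
pose G U := [set Z | components (boundary U) Z /\ (c%:E < diam Z)%E].
have finG : finite_set (\bigcup_(U in F) G U).
  apply: bigcup_finite; first exact: EK.
  by move=> U [UC _]; have [_ _] := pb UC; exact.
apply: sub_finite_set (_ : finite_set ([set P0] `|` hull K @` (\bigcup_(U in F) G U))).
  move=> P [PC dP]; have [->|PP0] := pselect (P = P0); [by left|right].
  have nP x : P0 x -> ~ P x.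
    by move=> P0x Px; apply: PP0; apply: (components_inj PC P0C); exists x.
  have /diam_gtP[p [q [Pp Pq pq]]] := dP.
  have pq' : p <> q by move=> E; move: pq; rewrite E mdistxx ltNge ltW.
  have [U [Z [UC ZC bWU bWZ ZP]]] := adjacent_boundary_component PC Pp Pq pq' (nP a Pa).
  set W := connected_component _ _ in bWU bWZ.
  have Wa : W a by apply: connected_component_refl; exact: nP.
  have Wb : W b by apply: (connected_component_max Pa _ (components_connected P0C)).
  have WP x : P x -> ~ W x by move=> Px /connected_component_sub.
  have dW : (c%:E < diam (boundary W))%E.
    by apply: (big W a b p q) => //; try exact: WP; exact: ltW.
  exists Z; last exact: hullE (components_nonempty ZC).
  exists U; split => //; last exact: diam_gt_subset dW.
  by apply: diam_closure_gt; apply: diam_gt_subset dW => x /bWU[].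
rewrite finite_setU; split; [exact: finite_set1|exact: finite_image].
Qed.

Lemma peano_components P : components K P -> locally_connected P.
Proof.
move=> KP; have clP := components_closed clK KP.
have [P1|] := pselect (forall x y, P x -> P y -> x = y).
  exact: locally_connected_subsingleton.
move=> /existsNP[p /existsNP[q /not_implyP[Pp /not_implyP[Pq pq]]]].
apply: im_kleinen_locally_connected => x e Px e0.
have e80 : 0 < e / 8 by rewrite divr_gt0.
have null e' (e'0 : 0 < e') := finite_large_domains KP Pp Pq pq e'0.
have bWP W : components (~` P) W -> boundary W `<=` P.
  by move=> WC y bw; apply: contrapT; exact: (component_boundary (closed_openC clP) WC bw).
have /finite_seqP[s sE] := null _ e80.
have [||d d0 dP] := @finite_uniform R _ s (fun W d => forall u v, boundary W u ->
  boundary W v -> mdist u v < d -> exists S, [/\ connected S, S u /\ S v, S `<=` P &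
    forall z, S z -> mdist u z < e / 8]).
- by move=> W d d' dd h u v bu bv uv; apply: h => //; exact: lt_le_trans dd.
- move=> W Ws; have [WC _] : components (~` P) W /\ (((e / 8)%:E < diam W)%E).
    by have : [set` s] W by []; rewrite -sE.
  have [a Wa] := components_nonempty WC; have nPa := components_sub WC Wa.
  have [U [Z [UC ZC bWU bWZ ZP]]] := adjacent_boundary_component KP Pp Pq pq nPa.
  rewrite -(components_eq WC Wa) in bWU bWZ.
  have [kb lb _] := pb UC.
  have kZ : compact Z.
    by apply: sphere_closed_compact; apply: components_closed ZC; exact: boundary_closed.
  have [d d0 dZ] := locally_connected_unif kZ (lb Z ZC) e80.
  exists d => // u v /bWZ Zu /bWZ Zv uv.
  have [S [cS _ Suv SZ Se]] := dZ u v Zu Zv uv.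
  by exists S; split => // z /SZ /ZP.
pose d' := Num.min d (e / 8); have d'0 : 0 < d' by rewrite lt_min d0.
have [d'd d'e] : d' <= d /\ d' <= e / 8 by rewrite /d' !ge_min !lexx orbT.
have d'20 : 0 < d' / 2 by rewrite divr_gt0.
have [f f0 fP] := locally_connected_unif (@sphere_compact R) (@sphere_locally_connected R) d'20.
exists f => // y Py xy; have [S [cS clS [Sx Sy] _ Sd]] := fP x y I I xy.
have HJ W : exists J, components (~` P) W -> W `&` S !=set0 ->
    [/\ connected J, S `&` boundary W `<=` J, J `<=` P & forall z, J z -> mdist x z < e].
  have [WC|] := pselect (components (~` P) W); last by exists set0.
  have [WS|] := pselect (W `&` S !=set0); last by exists set0.
  have [w [Ww Sw]] := WS.
  have [||u [Su bu]] := @connected_meets_boundary _ S W cS; first by exists w.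
    by exists x; split => // /(components_sub WC).
  have [big|small] := pselect (((e / 8)%:E < diam W)%E).
    have Ws : W \in s by have : [set` s] W by rewrite -sE.
    have HS v : exists T, boundary W v -> S v -> [/\ connected T, T u /\ T v, T `<=` P &
        forall z, T z -> mdist u z < e / 8].
      have [bv|] := pselect (boundary W v); last by exists set0.
      have [Sv|] := pselect (S v); last by exists set0.
      have [|T hT] := dP W Ws u v bu bv; last by exists T.
      have := Sd u Su; have := Sd v Sv; have := metric_triangle u x v.
      rewrite (metric_sym u x); lra.
    have [F hF] := choice HS.
    exists (\bigcup_(v in S `&` boundary W) F v) => _ _; split.
    - apply: bigcup_connected.
        by exists u => v [Sv bv]; have [_ []] := hF v bv Sv.
      by move=> v [Sv bv]; have [] := hF v bv Sv.
    - by move=> v [Sv bv]; exists v => //; have [_ []] := hF v bv Sv.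
    - by move=> z [v [Sv bv]]; have [_ _ h _] := hF v bv Sv; exact: h.
    - move=> z [v [Sv bv] Fz]; have [_ _ _ /(_ z Fz)] := hF v bv Sv.
      have := Sd u Su; have := metric_triangle x u z; lra.
  exists (boundary W) => _ _; split.
  - by apply: (domain_boundary_connected clP (components_connected KP) _ WC); exists p.
  - by move=> v [].
  - exact: bWP.
  - move=> z bz; have nsm : ~ ((e / 8)%:E < diam (closure W))%E by move=> /diam_closure_gt.
    have := diam_le_mdist nsm (subset_closure Ww) bz.1.
    have := Sd w Sw; have := metric_triangle x w z; lra.
have [J hJ] := choice HJ.
exists ((S `&` P) `|`
    \bigcup_(W in [set W | components (~` P) W /\ W `&` S !=set0]) J W); split.
- apply: joined_connected => //; first by exists x.
  by move=> W WC WS; have [] := hJ W WC WS.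
- by left.
- by left.
- by move=> z [[]//|[W [WC WS] Jz]]; have [_ _ h _] := hJ W WC WS; exact: h.
- move=> z [[/Sd Sz _]|[W [WC WS] Jz]]; last by have [_ _ _ h] := hJ W WC WS; exact: h.
  by lra.
Qed.

Lemma peano_of_boundaries : peano_compactum K.
Proof.
split => //; [exact: peano_components|exact: peano_nullity].
Qed.

End peano_from_boundaries.

(** * Three crossings and a domain *)

Section sphere_K33.
Context {R : realType}.
Local Notation S2 := (riemann_sphere R).
Implicit Types (A B C K O P S T U V W Z : set S2) (o p q x y z w : S2) (d e r : R).

Lemma sphere_K33 o (a b : nat -> S2) (E : nat -> nat -> set S2) :
  (forall i j, (i < 3)%N -> (j < 3)%N -> [/\ connected (E i j), compact (E i j),
    E i j (a i), E i j (b j) & ~ E i j o]) ->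
  ~ (forall i j k l, (i < 3)%N -> (j < 3)%N -> (k < 3)%N -> (l < 3)%N ->
    i != k -> j != l -> E i j `&` E k l = set0).
Proof.
move=> hE disj; apply: (@planar_K33 R (chart o \o a) (chart o \o b)
  (fun i j => chart o @` E i j)).
  move=> i j i3 j3; have [cE kE Ea Eb nEo] := hE i j i3 j3.
  have cc : {within E i j, continuous (chart o)}.
    apply: continuous_in_subspaceT => z; rewrite inE => Ez.
    by apply: chart_continuous => zo; apply: nEo; rewrite -zo.
  split; [exact: connected_continuous_connected|exact: continuous_compact| |].
    by exists (a i).
  by exists (b j).
move=> i j k l i3 j3 k3 l3 ik jl; rewrite -subset0 => _ [[z Ez <-] [w Ew]].
have [_ _ _ _ nEo] := hE i j i3 j3; have [_ _ _ _ nEo'] := hE k l k3 l3.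
move=> /(congr1 (chart_inv o)); rewrite !chart_invK; last 2 first.
- by move=> zo; apply: nEo; rewrite -zo.
- by move=> wo; apply: nEo'; rewrite -wo.
move=> wz; have : (E i j `&` E k l) z by split => //; rewrite -wz.
by rewrite disj.
Qed.

Lemma chain_hull e : 0 < e -> exists2 d, 0 < d & forall n (f : nat -> S2),
  (forall i, (i < n)%N -> mdist (f i) (f i.+1) < d) ->
  exists L, [/\ connected L, compact L, L (f 0%N), L (f n) &
    forall z, L z -> exists2 i, (i <= n)%N & mdist (f i) z < e].
Proof.
move=> e0; have [d d0 dP] := locally_connected_unif (@sphere_compact R)
  (@sphere_locally_connected R) e0.
exists d => //; elim=> [|n IH] f step.
  exists [set f 0%N]; split => //; [exact: connected1|exact: compact_set1|].
  by move=> _ ->; exists 0%N => //; rewrite mdistxx.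
have [|L [cL kL L0 Ln Ld]] := IH f; first by move=> i ni; apply: step; exact: leqW.
have [S [cS clS [Sn Sn1] _ Sd]] := dP _ _ I I (step n (ltnSn n)).
exists (L `|` S); split.
- by apply: connectedU => //; exists (f n).
- by apply: compactU => //; exact: sphere_closed_compact.
- by left.
- by right.
- move=> z [/Ld[i ni fz]|/Sd fz]; first by exists i => //; exact: leqW.
  by exists n.
Qed.

Definition neighborhood A r := [set z | exists2 a, A a & mdist a z < r].

(** A chain in C of minimal length from near J false to near J true is near each of
   them only at the corresponding end. Its first point x that is not within 2k of
   J false is not within 2k of J true either, and the two halves of the chain, each
   joined up to a continuum, form two arms L false and L true from x, each of which
   stays away from the other end. *)
Lemma split_crossing C (J : bool -> set S2) k r e : connected C ->
  (forall b, C `&` J b !=set0) -> 0 < r -> r <= k ->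
  (forall u v, J false u -> J true v -> 8 * k <= mdist u v) -> 0 < e ->
  exists x (l : bool -> S2) (L : bool -> set S2),
    [/\ C x, forall b, ~ neighborhood (J b) (2 * k) x &
     forall b, [/\ C (l b), neighborhood (J b) r (l b),
       connected (L b) /\ compact (L b), L b x /\ L b (l b) &
       forall z, L b z -> exists c, [/\ C c, mdist c z < e & ~ neighborhood (J (~~ b)) r c]]].
Proof.
move=> cC CJ r0 rk far e0; have k0 : 0 < k by exact: lt_le_trans rk.
have [d1 d10 hull] := chain_hull e0.
pose d := Num.min d1 k; have d0 : 0 < d by rewrite lt_min d10.
have [dd1 dk] : d <= d1 /\ d <= k by rewrite /d !ge_min !lexx orbT.
pose chain n (f : nat -> S2) := [/\ neighborhood (J false) r (f 0%N),
  neighborhood (J true) r (f n), forall i, C (f i) &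
  forall i, (i < n)%N -> mdist (f i) (f i.+1) < d].
have exn : exists n, `[< exists f, chain n f >].
  have [u [Cu Ju]] := CJ false; have [v [Cv Jv]] := CJ true.
  have [n [f [f0 fn Cf fd]]] := connected_chain cC Cu Cv d0.
  exists n; apply/asboolP; exists f; split => //.
    by exists u => //; rewrite f0 mdistxx.
  by exists v => //; rewrite fn mdistxx.
case: (ex_minnP exn) => n /asboolP[f [f0 fn Cf fd]] nmin.
have start i : (0 < i)%N -> (i <= n)%N -> ~ neighborhood (J false) r (f i).
  move=> i0 ni Ni; have : `[< exists g, chain (n - i)%N g >].
    apply/asboolP; exists (fun j => f (i + j)%N); split; rewrite ?addn0 ?subnKC//.
    by move=> j jn; rewrite addnS; apply: fd; rewrite -ltn_subRL.
  by move=> /nmin; rewrite leqNgt ltn_subrL i0 (leq_trans i0 ni).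
have finish i : (i < n)%N -> ~ neighborhood (J true) r (f i).
  move=> ni Ni; have : `[< exists g, chain i g >].
    apply/asboolP; exists f; split => //.
    by move=> j ji; apply: fd; exact: ltn_trans ni.
  by move=> /nmin; rewrite leqNgt ni.
have apart s t z : neighborhood (J false) s z -> neighborhood (J true) t z -> 8 * k < s + t.
  move=> [u Ju uz] [v Jv vz]; have := far u v Ju Jv.
  by have := metric_triangle u z v; rewrite (metric_sym z v); lra.
have exm : exists m, `[< ~ neighborhood (J false) (2 * k) (f m) >].
  by exists n; apply/asboolP => /apart /(_ fn); lra.
case: (ex_minnP exm) => m /asboolP nfm mmin.
have m0 : (0 < m)%N.
  rewrite lt0n; apply/eqP => m0; apply: nfm; rewrite m0.
  by have [u Ju uf] := f0; exists u => //; lra.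
have mn : (m <= n)%N by apply: mmin; apply/asboolP => /apart /(_ fn); lra.
have near_m : neighborhood (J false) (3 * k) (f m).
  have : neighborhood (J false) (2 * k) (f m.-1).
    apply: contrapT => h; have : (m <= m.-1)%N by apply: mmin; exact/asboolP.
    by rewrite leqNgt prednK// leqnn.
  move=> [u Ju uf]; exists u => //.
  have := fd m.-1; rewrite prednK// => /(_ mn).
  by have := metric_triangle u (f m.-1) (f m); lra.
have nfm' : ~ neighborhood (J true) (2 * k) (f m) by move=> /(apart _ _ _ near_m); lra.
have mltn : (m < n)%N.
  rewrite ltn_neqAle mn andbT; apply/eqP => mE; apply: nfm'; rewrite mE.
  by have [u Ju uf] := fn; exists u => //; lra.
have [|L0 [cL0 kL0 L00 L0m L0P]] := hull m f.
  by move=> i im; apply: lt_le_trans dd1; apply: fd; exact: ltn_trans mltn.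
have [|L1 [cL1 kL1 L10 L1m L1P]] := hull (n - m)%N (fun i => f (m + i)%N).
  move=> i im; apply: lt_le_trans dd1; rewrite addnS; apply: fd.
  by rewrite -ltn_subRL.
exists (f m), (fun b => if b then f n else f 0%N), (fun b => if b then L1 else L0).
split => //; first by case.
rewrite addn0 in L10; rewrite subnKC// in L1m.
case; split => //.
- move=> z /L1P[i im fz]; exists (f (m + i)%N); split => //=.
  apply: start; first by rewrite addn_gt0 m0.
  by rewrite -leq_subRL.
- move=> z /L0P[i im fz]; exists (f i); split => //=.
  by apply: finish; exact: leq_ltn_trans mltn.
Qed.

Lemma dense_continuum W F e : open W -> connected W -> W !=set0 -> compact F ->
  F `<=` closure W -> 0 < e ->
  exists T, [/\ compact T, connected T, T !=set0, T `<=` W & F `<=` neighborhood T e].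
Proof.
move=> oW cW [a Wa] kF FW e0.
pose good T := [/\ compact T, connected T, T a & T `<=` W].
have [||||T [kT cT Ta TW] FT] := @directed_cover R F good (fun T => neighborhood T e) kF.
- exists [set a]; split => //; [exact: compact_set1|exact: connected1|by move=> _ ->].
- move=> A B [kA cA Aa AW] [kB cB Ba BW]; split.
  + exact: compactU.
  + by apply: connectedU => //; exists a.
  + by left.
  + by move=> x [/AW|/BW].
- move=> A B AB; split; last by move=> z [u /AB Bu uz]; exists u.
  rewrite (_ : neighborhood A e = \bigcup_(u in A) [set z | mdist u z < e]).
    by apply: bigcup_open => u _; exact: open_mdist_lt.
  by apply/seteqP; split => z [u]; exists u.
- move=> x /FW /closure_mdist/(_ _ e0)[w Ww xw].
  have [T [kT cT Ta Tw TW]] := compact_connected_pair oW cW Wa Ww.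
  by exists T => //; exists w; rewrite // metric_sym.
by exists T; split => //; exists a.
Qed.

(** Each C j is cut at a point x_j into two arms that lead to J false and J true; a
   small continuum S in P closes the gap between the arm and J, and a small continuum
   X j of the sphere joins x_j to a continuum T in W that passes close to all
   crossings. These are the nine edges of a K_{3,3}. The gaps have to be closed
   inside P, since T may pass very close to their ends. The arms are thinner than
   the distance from T to P. The point o of P serves as the pole of a chart. *)
Lemma no_three_crossings P W (C : nat -> set S2) (J : bool -> set S2) o :
  compact P -> unif_loc_connected P -> open W -> connected W -> W `&` P = set0 ->
  (forall j, (j < 3)%N -> [/\ connected (C j), compact (C j), C j `<=` P &
     C j `<=` closure W]) ->
  (forall j l, (j < 3)%N -> (l < 3)%N -> j != l -> C j `&` C l = set0) ->
  (forall b, [/\ connected (J b), compact (J b) & J b `<=` P]) ->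
  J false `&` J true = set0 ->
  (forall j b, (j < 3)%N -> C j `&` J b !=set0) ->
  P o -> (forall j, (j < 3)%N -> ~ C j o) -> (forall b, ~ J b o) -> False.
Proof.
move=> kP uP oW cW WP hC dC hJ dJ CJ Po nCo nJo.
have clP := compact_closed_metric kP.
have [d1 d10 d1P] : exists2 d : R, 0 < d & forall x : 'I_3 * 'I_3, x \in enum {: 'I_3 * 'I_3} ->
    x.1 != x.2 -> forall p q, C x.1 p -> C x.2 q -> d <= mdist p q.
  apply: finite_uniform => [x e e' ee h h1 p q Cp Cq|x _].
    by rewrite (le_trans ee)//; exact: h.
  have [h1|h1] := eqVneq x.1 x.2; first by exists 1 => //; rewrite h1 eqxx.
  have [_ k1 _ _] := hC _ (ltn_ord x.1); have [_ k2 _ _] := hC _ (ltn_ord x.2).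
  have [|e e0 h] := disjoint_mdist k1 (compact_closed_metric k2); first exact: dC.
  by exists e.
have [d2 d20 d2P] : exists2 d : R, 0 < d & forall j : 'I_3, j \in enum 'I_3 ->
    forall p, C j p -> d <= mdist o p.
  apply: finite_uniform => [j e e' ee h p Cp|j _].
    by rewrite (le_trans ee)//; exact: h.
  have [_ k1 _ _] := hC j (ltn_ord j).
  have [e e0 h] := closed_mdist (compact_closed_metric k1) (nCo j (ltn_ord j)).
  by exists e.
have [d3 d30 d3P] : exists2 d, 0 < d & forall u v, J false u -> J true v -> d <= mdist u v.
  have [_ k1 _] := hJ false; have [_ k2 _] := hJ true.
  exact: disjoint_mdist k1 (compact_closed_metric k2) dJ.
(* All gaps and arms stay within k of their crossing, and 8k bounds the distances
   between the crossings, between J false and J true, and from o. *)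
pose k := Num.min d1 (Num.min d2 d3) / 8.
have k0 : 0 < k by rewrite divr_gt0// !lt_min d10 d20.
have k8 : 8 * k = Num.min d1 (Num.min d2 d3) by rewrite mulrC divfK.
have [k1 k2 k3] : [/\ 8 * k <= d1, 8 * k <= d2 & 8 * k <= d3].
  by rewrite k8 !ge_min !lexx /= ?orbT.
have farC j l p q : (j < 3)%N -> (l < 3)%N -> j != l -> C j p -> C l q -> 8 * k <= mdist p q.
  move=> j3 l3 jl Cp Cq; apply: le_trans k1 _.
  exact: (d1P (Ordinal j3, Ordinal l3) (mem_enum _ _) jl).
have faro j p : (j < 3)%N -> C j p -> 8 * k <= mdist o p.
  move=> j3 Cp; apply: le_trans k2 _.
  exact: (d2P (Ordinal j3) (mem_enum _ _)).
have farJ u v : J false u -> J true v -> 8 * k <= mdist u v.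
  by move=> Ju Jv; apply: le_trans k3 _; exact: d3P.
have farJ' b u v : J b u -> J (~~ b) v -> 8 * k <= mdist u v.
  by case: b => Ju Jv; [rewrite metric_sym|]; exact: farJ.
have [r1 r10 r1P] := uP k k0.
pose r := Num.min r1 k; have r0 : 0 < r by rewrite lt_min r10.
have [rr1 rk] : r <= r1 /\ r <= k by rewrite /r !ge_min !lexx orbT.
have [s s0 sP] := locally_connected_unif (@sphere_compact R)
  (@sphere_locally_connected R) k0.
have W0 : W !=set0.
  have [u [Cu _]] := CJ 0%N false isT; have [_ _ _ CW] := hC 0%N isT.
  have [|y [Wy _]] := CW u Cu setT; first exact: filterT.
  by exists y.
have [T [kT cT [t0 Tt0] TW CT]] : exists T, [/\ compact T, connected T, T !=set0, T `<=` W &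
    (C 0%N `|` C 1%N `|` C 2%N) `<=` neighborhood T s].
  have [_ kC0 _ CW0] := hC 0%N isT; have [_ kC1 _ CW1] := hC 1%N isT.
  have [_ kC2 _ CW2] := hC 2%N isT.
  apply: dense_continuum => //; first by apply: compactU => //; exact: compactU.
  by move=> x [[/CW0|/CW1]|/CW2].
have CjT j x : (j < 3)%N -> C j x -> neighborhood T s x.
  case: j => [|[|[|//]]] _ Cx; apply: CT; [by left; left|by left; right|by right].
have TP : T `&` P = set0.
  by rewrite -subset0 -WP; apply: setSI.
have [e1 e10 e1P] := disjoint_mdist kT clP TP.
pose e := Num.min e1 r; have e0 : 0 < e by rewrite lt_min e10.
have [ee1 er] : e <= e1 /\ e <= r by split; rewrite /e ge_min lexx ?orbT.
have hsplit (j : nat) : exists y : S2 * (bool -> S2) * (bool -> set S2), (j < 3)%N ->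
    [/\ C j y.1.1, forall b, ~ neighborhood (J b) (2 * k) y.1.1 &
     forall b, [/\ C j (y.1.2 b), neighborhood (J b) r (y.1.2 b),
       connected (y.2 b) /\ compact (y.2 b), y.2 b y.1.1 /\ y.2 b (y.1.2 b) &
       forall z, y.2 b z -> exists c, [/\ C j c, mdist c z < e & ~ neighborhood (J (~~ b)) r c]]].
  have [j3|_] := boolP (j < 3)%N; last by exists (o, fun=> o, fun=> set0).
  have [cC _ _ _] := hC j j3.
  have CJ' b := CJ j b j3.
  have [x [l [L h]]] := split_crossing cC CJ' r0 rk farJ e0.
  by exists (x, l, L).
have [y hy] := choice hsplit.
have hlink (jb : nat * bool) : exists S, (jb.1 < 3)%N -> [/\ connected S, compact S,
    S ((y jb.1).1.2 jb.2), S `&` J jb.2 !=set0 /\ S `<=` P &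
    forall z, S z -> mdist ((y jb.1).1.2 jb.2) z < k].
  case: jb => j b /=; have [j3|_] := boolP (j < 3)%N; last by exists set0.
  have [_ _ /(_ b)[Cl [u Ju ul] _ _ _]] := hy j j3.
  have [_ _ CP _] := hC j j3; have [_ _ JP] := hJ b.
  have [|S [cS clS [Sl Su] SP Sk]] := r1P _ _ (CP _ Cl) (JP _ Ju).
    by rewrite metric_sym; exact: lt_le_trans rr1.
  exists S => _; split => //; first exact: sphere_closed_compact.
  by split => //; exists u.
have [S hS] := choice hlink.
have hstar (j : nat) : exists S, (j < 3)%N -> [/\ connected S, compact S,
    S (y j).1.1, S `&` T !=set0 & forall z, S z -> mdist (y j).1.1 z < k].
  have [j3|_] := boolP (j < 3)%N; last by exists set0.
  have [Cx _ _] := hy j j3; have [t Tt tx] := CjT j _ j3 Cx.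
  have [|S' [cS clS [Sx St] _ Sk]] := sP (y j).1.1 t I I; first by rewrite metric_sym.
  exists S' => _; split => //; first exact: sphere_closed_compact.
  by exists t.
have [X hX] := choice hstar.
pose H (i : nat) := if i is 2 then T else J (i == 1)%N.
pose B (i j : nat) := if i is 2 then X j else S (j, (i == 1)%N) `|` (y j).2 (i == 1)%N.
have Btube i j z : (i < 3)%N -> (j < 3)%N -> B i j z -> exists2 c, C j c & mdist c z < k.
  move=> i3 j3; have [Cx _ hb] := hy j j3.
  case: i i3 => [|[|[|//]]] _ /=.
  - have [_ _ _ _ Sk] := hS (j, false) j3; have [Cl _ _ _ Lz] := hb false.
    case=> [/Sk|/Lz[c [Cc cz _]]]; first by exists ((y j).1.2 false).
    by exists c => //; lra.
  - have [_ _ _ _ Sk] := hS (j, true) j3; have [Cl _ _ _ Lz] := hb true.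
    case=> [/Sk|/Lz[c [Cc cz _]]]; first by exists ((y j).1.2 true).
    by exists c => //; lra.
  - have [_ _ _ _ Xk] := hX j j3.
    by move=> /Xk; exists (y j).1.1.
have HBarm b j z : (j < 3)%N -> J b z -> (S (j, ~~ b) `|` (y j).2 (~~ b)) z -> False.
  move=> j3 Jz; have [Cx _ /(_ (~~ b))[Cl [u Ju ul] _ _ Lz]] := hy j j3.
  have [_ _ _ _ Sk] := hS (j, ~~ b) j3.
  case=> [/Sk /= lz|/Lz[c [Cc cz]]].
    have := farJ' b z u Jz Ju; have := metric_triangle z ((y j).1.2 (~~ b)) u.
    rewrite (metric_sym z ((y j).1.2 (~~ b))) (metric_sym ((y j).1.2 (~~ b)) u); lra.
  by rewrite negbK; apply; exists z => //; rewrite metric_sym; lra.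
have HBstar b j z : (j < 3)%N -> J b z -> X j z -> False.
  move=> j3 Jz; have [Cx nx _] := hy j j3; have [_ _ _ _ Xk] := hX j j3.
  by move=> /Xk xz; apply: (nx b); exists z => //; rewrite metric_sym; lra.
have TBarm b j z : (j < 3)%N -> T z -> (S (j, b) `|` (y j).2 b) z -> False.
  move=> j3 Tz; have [Cx _ /(_ b)[Cl _ _ _ Lz]] := hy j j3.
  have [_ _ _ [_ SP] _] := hS (j, b) j3.
  case=> [/SP Pz|/Lz[c [Cc cz _]]].
    by have : (T `&` P) z by []; rewrite TP.
  have [_ _ CP _] := hC j j3.
  by have := e1P z c Tz (CP c Cc); rewrite metric_sym; lra.
have HBdisj i m l : (i < 3)%N -> (m < 3)%N -> (l < 3)%N -> i != m -> H i `&` B m l = set0.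
  move=> i3 m3 l3 im; rewrite -subset0 => z [Hz Bz].
  case: i m i3 m3 im Hz Bz => [|[|[|//]]] [|[|[|//]]] _ _ //= _ Hz Bz.
  - exact: (HBarm false l z).
  - exact: (HBstar false l z).
  - exact: (HBarm true l z).
  - exact: (HBstar true l z).
  - exact: (TBarm false l z).
  - exact: (TBarm true l z).
have HHdisj i m : (i < 3)%N -> (m < 3)%N -> i != m -> H i `&` H m = set0.
  have TJ b : T `&` J b = set0.
    by have [_ _ JP] := hJ b; rewrite -subset0 -TP; exact: setIS.
  case: i m => [|[|[|//]]] [|[|[|//]]] _ _ //= _; rewrite ?TJ//.
  - by rewrite setIC TJ.
  - by rewrite setIC.
  - by rewrite setIC TJ.
have hJ0 b : J b !=set0 by have [u [_ Ju]] := CJ 0%N b isT; exists u.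
have [u0 Ju0] := choice hJ0.
apply: (@sphere_K33 o (fun i => if i is 2 then t0 else u0 (i == 1)%N)
  (fun j => (y j).1.1) (fun i j => H i `|` B i j)).
  move=> i j i3 j3; have [Cx nx hb] := hy j j3.
  have nBo : ~ B i j o.
    by move=> /(Btube i j o i3 j3)[c Cc co]; have := faro j c j3 Cc; rewrite metric_sym; lra.
  have arm b : connected (J b `|` (S (j, b) `|` (y j).2 b)) /\
      compact (J b `|` (S (j, b) `|` (y j).2 b)).
    have [cJ kJ _] := hJ b; have [Cl _ [cL kL] [Lx Ll] _] := hb b.
    have [cS kS Sl [[v [Sv Jv]] _] _] := hS (j, b) j3; split.
      apply: connectedU => //; first by exists v; split => //; left.
      by apply: connectedU => //; exists ((y j).1.2 b).
    by apply: compactU => //; exact: compactU.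
  case: i i3 nBo => [|[|[|//]]] _ nBo /=.
  - have [cE kE] := arm false; have [_ _ _ [Lx _] _] := hb false.
    by split => //; [left|right; right|move=> [/nJo|]].
  - have [cE kE] := arm true; have [_ _ _ [Lx _] _] := hb true.
    by split => //; [left|right; right|move=> [/nJo|]].
  - have [cX kX Xx [t [Xt Tt]] _] := hX j j3; split.
    + by apply: connectedU => //; exists t.
    + exact: compactU.
    + by left.
    + by right.
    + by move=> [To|//]; have : (T `&` P) o by []; rewrite TP.
move=> i j m l i3 j3 m3 l3 im jl; rewrite setIUl !setIUr.
rewrite HHdisj// HBdisj// (setIC (B i j) (H m)) HBdisj// 1?eq_sym// !set0U.
rewrite -subset0 => z [/(Btube i j z i3 j3)[c Cc cz] /(Btube m l z m3 l3)[c' Cc' cz']].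
have := farC j l c c' j3 l3 jl Cc Cc'; have := metric_triangle c z c'.
by rewrite (metric_sym z c'); lra.
Qed.

End sphere_K33.

(** * From the compactum to the boundaries *)

Section torhorst.
Context {R : realType}.
Local Notation S2 := (riemann_sphere R).
Implicit Types (A B C K O P S T U V W Z : set S2) (o p q x y z w : S2) (d e r : R).

(** If the boundary B of W is not connected im kleinen at x, points of B arbitrarily
   close to x lie in components of B inside a closed ball around x that miss x, yet
   reach distance e from x. *)
Lemma torhorst P p q a : compact P -> connected P -> locally_connected P ->
  P p -> P q -> p <> q -> ~ P a ->
  locally_connected (boundary (connected_component (~` P) a)).
Proof.
move=> kP cP lP Pp Pq pq nPa; set W := connected_component _ _.
have clP := compact_closed_metric kP; have oP : open (~` P) by exact: closed_openC.
have WC : components (~` P) W by exact: components_component.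
have oW := component_open oP WC; have cW := components_connected WC.
have uP := locally_connected_unif kP lP.
pose B := boundary W; rewrite -/B.
have BP : B `<=` P.
  by move=> y By; apply: contrapT; exact: (component_boundary oP WC By).
have BW : B `<=` closure W by move=> y [].
have kB : compact B by apply: sphere_closed_compact; exact: boundary_closed.
have cB : connected B by apply: (domain_boundary_connected clP cP _ WC); exists p.
apply: im_kleinen_locally_connected => x e0 Bx e00.
apply: contrapT => nS.
pose joined y := exists S, [/\ connected S, S x, S y, S `<=` B & forall z, S z -> mdist x z < e0].
have bad d : 0 < d -> exists y, [/\ B y, mdist x y < d & ~ joined y].
  move=> d0; apply: contrapT => nex; apply: nS; exists d => // y By xy.
  by apply: contrapT => nj; apply: nex; exists y.
have pq0 : 0 < mdist p q by rewrite mdist_gt0; exact/eqP.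
(* The bound on e by the size of P leaves a point v of P far from x, to be used as a
   pole. *)
pose e := Num.min e0 (mdist p q / 8) / 2.
have e0' : 0 < e by rewrite divr_gt0// lt_min e00 divr_gt0.
have [ee0 epq] : e < e0 /\ 16 * e <= mdist p q.
  have m1 : Num.min e0 (mdist p q / 8) <= e0 by rewrite ge_min lexx.
  have m2 : Num.min e0 (mdist p q / 8) <= mdist p q / 8 by rewrite ge_min lexx orbT.
  by move: m1 m2 e0'; rewrite /e; set m := Num.min _ _; split; lra.
have [v Pv xv] : exists2 v, P v & 8 * e <= mdist x v.
  have [h|h] := leP (8 * e) (mdist x p); first by exists p.
  exists q => //; have := metric_triangle p x q; rewrite (metric_sym p x); lra.
pose F := B `&` [set z | mdist x z <= e].
pose Q y := connected_component F y.
have clF : closed F by apply: closedI; [exact: boundary_closed|exact: closed_mdist_le].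
have FB y : F y -> B y by case.
have badQ y : B y -> mdist x y < e -> ~ joined y -> F y /\ ~ Q y x.
  move=> By xy nj; split; first by split => //; exact: ltW.
  move=> Qx; apply: nj; exists (Q y); split => //.
  - exact: component_connected.
  - by apply: connected_component_refl; split => //; exact: ltW.
  - by move=> z /connected_component_sub[].
  - by move=> z /connected_component_sub[_ /=] /le_lt_trans; apply.
have reach y : B y -> mdist x y < e -> ~ joined y -> exists2 t, Q y t & e <= mdist x t.
  move=> By xy nj; apply: component_bump => //.
  apply: contrapT => nex; apply: nj; exists B; split => //.
  move=> z Bz; rewrite (lt_trans _ ee0)// ltNge; apply/negP => h; apply: nex.
  by exists z.
(* The far ends of the bad components cluster at a point t as the components
   approach x. *)
pose ends d := [set t | exists y,
  [/\ B y, mdist x y < d, mdist x y < e, ~ joined y & Q y t /\ e <= mdist x t]].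
pose G := filter_from [set d : R | 0 < d] ends.
have PG : ProperFilter G.
  apply: filter_from_proper.
    apply: filter_from_filter; first by exists 1; exact: ltr01.
    move=> d d' /= d0 d'0; exists (Num.min d d'); first by rewrite /= lt_min d0.
    move=> t [y [By]]; rewrite lt_min => /andP[xd xd'] xe nj h.
    by split; exists y.
  move=> d /= d0; have m0 : 0 < Num.min d e by rewrite lt_min d0.
  have [y [By]] := bad _ m0; rewrite lt_min => /andP[xd xe] nj.
  by have [t Qt et] := reach y By xe nj; exists t, y.
have GT : G setT by exists 1 => //; exact: ltr01.
have [t [_ clt]] := @sphere_compact R G PG GT.
have pick d d' : 0 < d -> 0 < d' -> exists y t', [/\ B y, mdist x y < d,
    mdist x y < e, ~ joined y & [/\ Q y t', e <= mdist x t' & mdist t t' < d']].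
  move=> d0 d'0; have nt : nbhs t [set z | mdist t z < d'].
    by apply/nbhs_mdist; exists d'.
  have Gd : G (ends d) by exists d.
  have [t' [[y [By xy xe nj [Qt et]]] tt']] := clt _ _ Gd nt.
  by exists y, t'.
have Pt : P t.
  rewrite (closure_id P).1//; apply/closure_mdist => d d0.
  have [y [t' [_ _ _ _ [Qt _ tt']]]] := pick d d d0 d0.
  by exists t' => //; apply: BP; apply: FB; exact: connected_component_sub Qt.
have ext : e <= mdist x t.
  rewrite leNgt; apply/negP => h.
  have d0 : 0 < e - mdist x t by rewrite subr_gt0.
  have [y [t' [_ _ _ _ [Qt et tt']]]] := pick _ _ d0 d0.
  by have := metric_triangle x t t'; lra.
have text : mdist x t <= e.
  rewrite leNgt; apply/negP => h.
  have d0 : 0 < mdist x t - e by rewrite subr_gt0.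
  have [y [t' [_ _ _ _ [Qt et tt']]]] := pick _ _ d0 d0.
  have [_ /=] := connected_component_sub Qt.
  by have := metric_triangle x t' t; rewrite (metric_sym t' t); lra.
have e40 : 0 < e / 4 by rewrite divr_gt0.
have [d1 d10 d1P] := uP _ e40.
have avoid y : ~ Q y x -> exists2 d, 0 < d & forall z, Q y z -> d <= mdist x z.
  by move=> nQx; apply: closed_mdist nQx; exact: component_closed.
(* Each new point is closer to x than the previous components, hence lies in a new
   one. *)
have [y0 [t0 [By0 xy0 xye0 nj0 [Qt0 et0 tt0]]]] := pick _ _ d10 d10.
have [Fy0 nQ0] := badQ y0 By0 xye0 nj0; have [r0 r00 r0P] := avoid y0 nQ0.
have m1 : 0 < Num.min d1 r0 by rewrite lt_min d10.
have [y1 [t1 [By1 xy1 xye1 nj1 [Qt1 et1 tt1]]]] := pick _ _ m1 d10.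
have [Fy1 nQ1] := badQ y1 By1 xye1 nj1; have [r1 r10 r1P] := avoid y1 nQ1.
have m2 : 0 < Num.min (Num.min d1 r0) r1 by rewrite lt_min m1.
have [y2 [t2 [By2 xy2 xye2 nj2 [Qt2 et2 tt2]]]] := pick _ _ m2 d10.
have [Fy2 nQ2] := badQ y2 By2 xye2 nj2.
move: xy1 xy2; rewrite !lt_min => /andP[xy1 xyr1] /andP[/andP[xy2 xyr2] xyr2'].
pose yy (j : nat) := if j is 0 then y0 else if j is 1 then y1 else y2.
pose tt (j : nat) := if j is 0 then t0 else if j is 1 then t1 else t2.
have yyP j : [/\ F (yy j), mdist x (yy j) < d1, Q (yy j) (tt j) & mdist t (tt j) < d1].
  by case: j => [|[|j]].
have Qdisj y y' : F y -> F y' -> ~ Q y y' -> Q y `&` Q y' = set0.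
  move=> Fy Fy' nQ; rewrite -subset0 => z Qz; apply: nQ.
  have -> : Q y = Q y'.
    by apply: (components_inj (A := F)); [exact: components_component|exact: components_component|exists z].
  exact: connected_component_refl.
have n01 : ~ Q y0 y1 by move=> /r0P; rewrite leNgt xyr1.
have n02 : ~ Q y0 y2 by move=> /r0P; rewrite leNgt xyr2.
have n12 : ~ Q y1 y2 by move=> /r1P; rewrite leNgt xyr2'.
have QF y z : Q y z -> F z := @connected_component_sub _ F y z.
have hlinks (u : S2) (f : nat -> S2) : P u -> (forall j, P (f j)) ->
    (forall j, mdist u (f j) < d1) -> exists J, [/\ connected J, compact J, J `<=` P,
      forall j, (j < 3)%N -> J (f j) & forall z, J z -> mdist u z < e / 4].
  move=> Pu Pf uf; have [S0 [c0 l0 [u0 f0] P0 h0]] := d1P _ _ Pu (Pf 0%N) (uf 0%N).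
  have [S1 [c1 l1 [u1 f1] P1 h1]] := d1P _ _ Pu (Pf 1%N) (uf 1%N).
  have [S2' [c2 l2 [u2 f2] P2 h2]] := d1P _ _ Pu (Pf 2%N) (uf 2%N).
  exists (S0 `|` S1 `|` S2'); split.
  - apply: connectedU => //; first by exists u; split => //; left.
    by apply: connectedU => //; exists u.
  - by apply: compactU; [apply: compactU|]; exact: sphere_closed_compact.
  - by move=> z [[/P0|/P1]|/P2].
  - by move=> [|[|[|//]]] _; [left; left|left; right|right].
  - by move=> z [[/h0|/h1]|/h2].
have [||J0 [cJ0 kJ0 J0P J0y J0e]] := hlinks x yy (BP x Bx).
- by move=> j; have [Fy _ _ _] := yyP j; exact/BP/FB.
- by move=> j; have [] := yyP j.
have [||J1 [cJ1 kJ1 J1P J1t J1e]] := hlinks t tt Pt.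
- by move=> j; have [_ _ Qt _] := yyP j; exact/BP/FB/(QF _ _ Qt).
- by move=> j; have [] := yyP j.
apply: (@no_three_crossings R P W (fun j => Q (yy j)) (fun b => if b then J1 else J0) v kP uP oW cW).
- by rewrite -subset0 => z [/(components_sub WC)].
- move=> j j3; split.
  + exact: component_connected.
  + by apply: sphere_closed_compact; exact: component_closed.
  + by move=> z /QF /FB /BP.
  + by move=> z /QF /FB /BW.
- case=> [|[|[|//]]] [|[|[|//]]] _ _ //= _.
  + exact: Qdisj.
  + exact: Qdisj.
  + by rewrite setIC; exact: Qdisj.
  + exact: Qdisj.
  + by rewrite setIC; exact: Qdisj.
  + by rewrite setIC; exact: Qdisj.
- by case.
- rewrite -subset0 => z [/J0e xz /J1e tz].
  by have := metric_triangle x z t; rewrite (metric_sym z t); lra.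
- move=> j b j3; have [Fy _ Qt _] := yyP j; case: b.
    by exists (tt j); split => //; exact: J1t.
  by exists (yy j); split; [exact: connected_component_refl|exact: J0y].
- exact: Pv.
- by move=> j _ /QF[_ /=]; lra.
- case; first by move=> /J1e; have := metric_triangle x t v; lra.
  by move=> /J0e; lra.
Qed.

Context (K U : set S2) (pK : peano_compactum K) (EK : null_complement K)
  (UC : components (~` K) U).

Let kK : compact K. Proof. by have [] := pK. Qed.
Let clK : closed K. Proof. exact: compact_closed_metric. Qed.

(** The component of the complement of K adjacent to P in the domain of a must be U:
   any other one would keep the closure of U away from P. *)
Lemma boundary_trace P p q a : components K P -> P p -> P q -> p <> q -> U a ->
  boundary U `&` P !=set0 ->
  boundary (connected_component (~` P) a) = boundary U `&` P.
Proof.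
move=> KP Pp Pq pq Ua [z [bz Pz]].
have nPa : ~ P a by move=> /(components_sub KP); exact: (components_sub UC Ua).
have WC : components (~` P) (connected_component (~` P) a) by exact: components_component.
have clP := components_closed clK KP; have oP := closed_openC clP.
have [V [VC VW bWV other]] := adjacent_component kK EK KP Pp Pq pq nPa.
have UV : U = V.
  apply: contrapT => nUV; have := other U UC Ua nUV.
  by move=> /seteqP[/(_ z) + _]; apply; split => //; exact: bz.1.
rewrite -UV in VW bWV; apply/seteqP; split => w bw.
  by split; [exact: bWV|apply: contrapT; exact: (component_boundary oP WC bw)].
rewrite boundary_open; last exact: component_open WC.
have [bUw Pw] := bw; split; last by move=> /(components_sub WC).
by apply: closureS bUw.1.
Qed.

Lemma boundary_component Z p q : components (boundary U) Z -> Z p -> Z q -> p <> q ->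
  exists P a, [/\ components K P, P p /\ P q, ~ P a /\ Z = boundary U `&` P &
    Z = boundary (connected_component (~` P) a)].
Proof.
move=> ZC Zp Zq pq; have [a Ua] := components_nonempty UC.
have ZK : Z `<=` K.
  move=> x /(components_sub ZC) bx; apply: contrapT.
  exact: (component_boundary (closed_openC clK) UC bx).
have [|P KP ZP] := components_ex (components_connected ZC) _ ZK; first by exists p.
have [Pp Pq] := (ZP p Zp, ZP q Zq).
have bUP : boundary U `&` P !=set0.
  by exists p; split => //; exact: components_sub ZC _ Zp.
have tr := boundary_trace KP Pp Pq pq Ua bUP.
have nPa : ~ P a by move=> /(components_sub KP); exact: (components_sub UC Ua).
have WC : components (~` P) (connected_component (~` P) a) by exact: components_component.
have ZE : Z = boundary U `&` P.
  apply/seteqP; split => x.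
    by move=> Zx; split; [exact: components_sub ZC _ Zx|exact: ZP].
  have cb : connected (boundary U `&` P).
    rewrite -tr; apply: (domain_boundary_connected _ (components_connected KP) _ WC).
      exact: components_closed clK KP.
    by exists p.
  apply: (components_max ZC cb); first by move=> y [].
  by exists p; split => //; split => //; exact: components_sub ZC _ Zp.
by exists P, a; split => //; rewrite tr.
Qed.

Lemma peano_boundary : peano_compactum (boundary U).
Proof.
have [_ lK nK] := pK; split.
- by apply: sphere_closed_compact; exact: boundary_closed.
- move=> Z ZC.
  have [Z1|] := pselect (forall x y, Z x -> Z y -> x = y).
    exact: locally_connected_subsingleton.
  move=> /existsNP[p /existsNP[q /not_implyP[Zp /not_implyP[Zq pq]]]].
  have [P [a [KP [Pp Pq] [nPa _] ->]]] := boundary_component ZC Zp Zq pq.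
  apply: (torhorst _ (components_connected KP) (lK P KP) Pp Pq pq nPa).
  by apply: sphere_closed_compact; exact: components_closed clK KP.
- move=> C C0.
  apply: sub_finite_set (finite_image (fun P => boundary U `&` P) (nK C C0)) => Z [ZC dZ].
  have /diam_gtP[p [q [Zp Zq pq]]] := dZ.
  have pq' : p <> q by move=> E; move: pq; rewrite E mdistxx ltNge ltW.
  have [P [a [KP _ [_ ZE] _]]] := boundary_component ZC Zp Zq pq'.
  exists P => //; split => //; apply: diam_gt_subset dZ.
  by rewrite ZE; exact: subIsetr.
Qed.

End torhorst.

Theorem mainTheorem4 (R : realType) (K : set (riemann_sphere R)) :
  E_compactum K ->
  (peano_compactum K <->
   forall U : set (riemann_sphere R),
     components (~` K) U -> peano_compactum (boundary U)).
Proof.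
move=> [kK EK]; split=> [pK U UC|pb]; first exact: (peano_boundary pK EK UC).
exact: (peano_of_boundaries kK EK pb).
Qed.
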